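(* Let $a<b$ and $a\le A<B\le b$ be real numbers, let $0<\alpha,\beta<1$, let $y_a,y_b\in\mathbb R$, and let $L:[a,b]\times\mathbb R^3\to\mathbb R$, $(x,y,u,v)\mapsto L(x,y,u,v)$, be of class $C^1$. Consider $$J^*(y)=\int_A^B L\big(x,y(x),\,{}_a^CD_x^\alpha y(x),\,{}_x^CD_b^\beta y(x)\big)\,dx,\qquad y\in {}_a^{\alpha}E_b^{\beta}.$$ Let $y\in {}_a^{\alpha}E_b^{\beta}$ be a local minimizer of $J^*$ among the functions satisfying the boundary conditions $y(a)=y_a$ and $y(b)=y_b$. Assume that, along $y$, $\partial_3L$ has a continuous right Riemann--Liouville derivative ${}_xD_B^\alpha\partial_3L$ on $[a,B]$ and $\partial_4L$ has a continuous left Riemann--Liouville derivative ${}_AD_x^\beta\partial_4L$ on $[A,b]$. Then $y$ satisfies the system $$\left\{\begin{array}{ll} \partial_2 L + {}_xD_B^\alpha\, \partial_3 L +{}_AD_x^\beta\, \partial_4 L=0 & \text{for all } x \in [A,B],\\ {}_xD_B^\alpha\,\partial_3 L -{}_xD_A^\alpha\,\partial_3 L=0 & \text{for all } x \in [a,A],\\ {}_AD_x^\beta\, \partial_4 L -{}_BD_x^\beta\,\partial_4 L=0 & \text{for all } x \in [B,b], \end{array}\right.$$ where all partial derivatives of $L$ are evaluated at $[y](x)=(x,y(x),{}_a^CD_x^\alpha y(x),{}_x^CD_b^\beta y(x))$.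
   Context: Fractional operators. Let $0<\gamma<1$, $p<q$ real, $\Gamma$ the Euler gamma function. The left and right Riemann--Liouville derivatives of order $\gamma$ are $${}_pD_x^\gamma f(x)=\frac{1}{\Gamma(1-\gamma)}\frac{d}{dx}\int_p^x (x-t)^{-\gamma}f(t)\,dt,\qquad {}_xD_q^\gamma f(x)=\frac{-1}{\Gamma(1-\gamma)}\frac{d}{dx}\int_x^q (t-x)^{-\gamma}f(t)\,dt$$ (one-sided derivatives at endpoints). The left and right Caputo derivatives are, for absolutely continuous $f:[a,b]\to\mathbb R$, $${}_a^CD_x^\gamma f(x)=\frac{1}{\Gamma(1-\gamma)}\int_a^x (x-t)^{-\gamma}f'(t)\,dt,\qquad {}_x^CD_b^\gamma f(x)=\frac{-1}{\Gamma(1-\gamma)}\int_x^b (t-x)^{-\gamma}f'(t)\,dt,$$ with the value at $x=a$ (left) or $x=b$ (right) understood as the limit. Function space: ${}_a^{\alpha}E_b^{\beta}$ is the set of $y:[a,b]\to\mathbb R$ for which ${}_a^CD_x^\alpha y$ and ${}_x^CD_b^\beta y$ exist and are continuous on $[a,b]$. $\partial_iL$ is the partial derivative of $L$ with respect to its $i$-th variable, $i=1,2,3,4$. An expression such as ${}_xD_B^\alpha\partial_3L$ means the operator applied to the function $x\mapsto\partial_3L[y](x)$. Fix a norm $\|\cdot\|$ on ${}_a^{\alpha}E_b^{\beta}$ (any norm). $y$ is a local minimizer of $J^*$ subject to given conditions if it satisfies them and there is $\delta>0$ with $J^*(y)\le J^*(y_1)$ for every $y_1\in{}_a^{\alpha}E_b^{\beta}$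 satisfying the same conditions with $\|y-y_1\|<\delta$. Convention: if $A=a$ the second line of the system is void; if $B=b$ the third line is void. *)

(* Defs.v *)
From HB Require Import structures.
From mathcomp Require Import all_boot all_order all_algebra.
From mathcomp Require Import all_classical all_reals all_analysis.

Set Implicit Arguments.
Unset Strict Implicit.
Unset Printing Implicit Defensive.

Import Order.TTheory GRing.Theory Num.Theory.
Import numFieldNormedType.Exports.
Local Open Scope classical_set_scope.
Local Open Scope ring_scope.

(* Functions on [a, b] are represented by functions R -> R of which only the
   values on [a, b] matter. *)

Definition Gamma (R : realType) (z : R) : R :=
  \int[lebesgue_measure]_(t in `]0, +oo[) (t `^ (z - 1) * expR (- t)).

(* Derivative at x of a function defined on [p, q]: two-sided in the interior,
   one-sided at p and at q. *)
Definition quotient_in (R : realType) (p q : R) (f : R -> R) (x : R) :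
    set_system R :=
  (f t - f x) / (t - x) @[t --> within `[p, q] x^'].

Definition derivable_in (R : realType) (p q : R) (f : R -> R) (x : R) : Prop :=
  cvg (quotient_in p q f x).

Definition derive_in (R : realType) (p q : R) (f : R -> R) (x : R) : R :=
  lim (quotient_in p q f x).

(* In the kernels below, [0 `^ (- g) = 0] for [g != 0]; this concerns a single
   point of the domain of integration. *)
Definition left_kernel (R : realType) (g : R) (f : R -> R) (x t : R) : R :=
  (x - t) `^ (- g) * f t.

Definition right_kernel (R : realType) (g : R) (f : R -> R) (x t : R) : R :=
  (t - x) `^ (- g) * f t.

(* Riemann-Liouville derivatives of a function on [p, q]; the left one has base
   point p, the right one has base point q. *)
Definition RL_left (R : realType) (p q g : R) (f : R -> R) (x : R) : R :=
  (Gamma (1 - g))^-1 *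
  derive_in p q
    (fun s => \int[lebesgue_measure]_(t in `[p, s]) left_kernel g f s t) x.

Definition RL_right (R : realType) (p q g : R) (f : R -> R) (x : R) : R :=
  - (Gamma (1 - g))^-1 *
  derive_in p q
    (fun s => \int[lebesgue_measure]_(t in `[s, q]) right_kernel g f s t) x.

Definition RL_left_exists (R : realType) (p q g : R) (f : R -> R) (x : R) :
    Prop :=
  (forall s, s \in `[p, q] ->
     lebesgue_measure.-integrable `[p, s] (EFin \o left_kernel g f s)) /\
  derivable_in p q
    (fun s => \int[lebesgue_measure]_(t in `[p, s]) left_kernel g f s t) x.

Definition RL_right_exists (R : realType) (p q g : R) (f : R -> R) (x : R) :
    Prop :=
  (forall s, s \in `[p, q] ->
     lebesgue_measure.-integrable `[s, q] (EFin \o right_kernel g f s)) /\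
  derivable_in p q
    (fun s => \int[lebesgue_measure]_(t in `[s, q]) right_kernel g f s t) x.

Definition abs_continuous (R : realType) (a b : R) (f : R -> R) : Prop :=
  forall e : R, 0 < e -> exists2 d : R, 0 < d &
    forall (n : nat) (u v : 'I_n -> R),
      (forall i, [/\ a <= u i, u i <= v i & v i <= b]) ->
      trivIset setT (fun i => [set` `]u i, v i[]) ->
      \sum_(i < n) (v i - u i) < d ->
      \sum_(i < n) `|f (v i) - f (u i)| < e.

Definition caputo_left_int (R : realType) (a g : R) (f : R -> R) (x : R) : R :=
  (Gamma (1 - g))^-1 *
  \int[lebesgue_measure]_(t in `[a, x]) left_kernel g (derive1 f) x t.

Definition caputo_right_int (R : realType) (b g : R) (f : R -> R) (x : R) : R :=
  - (Gamma (1 - g))^-1 *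
  \int[lebesgue_measure]_(t in `[x, b]) right_kernel g (derive1 f) x t.

(* At the base point the integral is over a single point; the value of the
   Caputo derivative there is the limit. *)
Definition caputo_left (R : realType) (a g : R) (f : R -> R) (x : R) : R :=
  if x == a then lim (caputo_left_int a g f s @[s --> a^'+])
  else caputo_left_int a g f x.

Definition caputo_right (R : realType) (b g : R) (f : R -> R) (x : R) : R :=
  if x == b then lim (caputo_right_int b g f s @[s --> b^'-])
  else caputo_right_int b g f x.

(* [derive1 f] is total, so the existence of the Caputo derivatives includes
   derivability of f almost everywhere (which holds for every absolutely
   continuous f). *)
Definition caputo_left_exists (R : realType) (a b g : R) (f : R -> R) : Prop :=
  [/\ abs_continuous a b f,
      {ae lebesgue_measure, forall t : R, t \in `]a, b[ -> derivable f t 1},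
      (forall x, x \in `]a, b] ->
         lebesgue_measure.-integrable `[a, x]
           (EFin \o left_kernel g (derive1 f) x)) &
      cvg (caputo_left_int a g f s @[s --> a^'+])].

Definition caputo_right_exists (R : realType) (a b g : R) (f : R -> R) : Prop :=
  [/\ abs_continuous a b f,
      {ae lebesgue_measure, forall t : R, t \in `]a, b[ -> derivable f t 1},
      (forall x, x \in `[a, b[ ->
         lebesgue_measure.-integrable `[x, b]
           (EFin \o right_kernel g (derive1 f) x)) &
      cvg (caputo_right_int b g f s @[s --> b^'-])].

Definition caputo_space (R : realType) (a b alpha beta : R) : set (R -> R) :=
  [set y | [/\ caputo_left_exists a b alpha y,
               {within `[a, b], continuous (caputo_left a alpha y)},
               caputo_right_exists a b beta y &
               {within `[a, b], continuous (caputo_right b beta y)}]].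

(* A norm on the space of the restrictions to [a, b] of the elements of E. *)
Definition is_norm_on (R : realType) (a b : R) (E : set (R -> R))
    (N : (R -> R) -> R) : Prop :=
  [/\ (forall y z, E y -> E z -> {in `[a, b], y =1 z} -> N y = N z),
      (forall y, E y -> 0 <= N y),
      (forall y, E y -> N y = 0 -> {in `[a, b], forall x, y x = 0}),
      (forall c y, E y -> N (fun x => c * y x) = `|c| * N y) &
      (forall y z, E y -> E z -> N (y \+ z) <= N y + N z)].

Definition local_minimizer (R : realType) (E : set (R -> R))
    (N : (R -> R) -> R) (J : (R -> R) -> R) (cond : (R -> R) -> Prop)
    (y : R -> R) : Prop :=
  [/\ E y, cond y &
      exists2 d : R, 0 < d &
        forall z, E z -> cond z -> N (y \- z) < d -> J y <= J z].

Definition partial1 (R : realType) (a b : R) (L : R -> R -> R -> R -> R)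
  (x y u v : R) : R := derive_in a b (fun s => L s y u v) x.
Definition partial2 (R : realType) (L : R -> R -> R -> R -> R)
  (x y u v : R) : R := derive1 (fun s => L x s u v) y.
Definition partial3 (R : realType) (L : R -> R -> R -> R -> R)
  (x y u v : R) : R := derive1 (fun s => L x y s v) u.
Definition partial4 (R : realType) (L : R -> R -> R -> R -> R)
  (x y u v : R) : R := derive1 (fun s => L x y u s) v.

Definition continuous_on_strip (R : realType) (a b : R)
    (F : R -> R -> R -> R -> R) : Prop :=
  {within [set z : R * R * R * R | z.1.1.1 \in `[a, b]],
     continuous (fun z : R * R * R * R => F z.1.1.1 z.1.1.2 z.1.2 z.2)}.

(* L is of class C^1 on [a, b] x R^3. *)
Definition C1_on_strip (R : realType) (a b : R) (L : R -> R -> R -> R -> R) :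
    Prop :=
  (forall x y u v : R, x \in `[a, b] ->
     [/\ derivable_in a b (fun s => L s y u v) x,
         derivable (fun s => L x s u v) y 1,
         derivable (fun s => L x y s v) u 1 &
         derivable (fun s => L x y u s) v 1]) /\
  [/\ continuous_on_strip a b (partial1 a b L),
      continuous_on_strip a b (partial2 L),
      continuous_on_strip a b (partial3 L) &
      continuous_on_strip a b (partial4 L)].

(* x |-> F[y](x) *)
Definition along (R : realType) (a b alpha beta : R)
    (F : R -> R -> R -> R -> R) (y : R -> R) (x : R) : R :=
  F x (y x) (caputo_left a alpha y x) (caputo_right b beta y x).

Definition Jstar (R : realType) (a b A B alpha beta : R)
    (L : R -> R -> R -> R -> R) (y : R -> R) : R :=
  \int[lebesgue_measure]_(x in `[A, B]) along a b alpha beta L y x.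

(* Main.v *)
Require Import Defs.
From HB Require Import structures.
From mathcomp Require Import all_boot all_order all_algebra.
From mathcomp Require Import all_classical all_reals all_analysis.
From mathcomp Require Import measurable_realfun ring lra.

Import Order.TTheory GRing.Theory Num.Theory.
Import numFieldNormedType.Exports.
Local Open Scope classical_set_scope.
Local Open Scope ring_scope.

(* Perturb the minimizer by [e * eta], where [eta] is the primitive of a
   continuous function [g] of integral 0 on [a, b]. The Caputo derivatives of
   [eta] are Abel convolutions of [g], so Fubini's theorem turns the vanishing
   first variation into [\int_a^b g H = 0], where
     H = \int_x^B d2L 1_[A,B] + I_right (d3L 1_[A,B]) - I_left (d4L 1_[A,B])
   is continuous ([I_right], [I_left] are the fractional integrals of orders
   1 - alpha and 1 - beta). Hence [H] is constant on [a, b]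
   (du Bois-Reymond). On [A, B], the derivative of [H = const] is the first
   equation; on [a, A] (resp. [B, b]) only the second (resp. third) summand
   varies, and its constancy says that the fractional integrals with the two
   base points differ by a constant. *)

Set Implicit Arguments.
Unset Strict Implicit.
Unset Printing Implicit Defensive.

(** * Abel kernels and fractional integrals *)

(** Taking the derivative [g] of the variation as the free datum suits the regularity at hand: a
    Caputo derivative sees [eta] only through [eta' = g], so the first variation is linear in [g]
    and nothing has to be differentiated along [y], where the partials of [L] are merely continuous.
    The Riemann-Liouville hypotheses enter only when [H = C] is differentiated. Mean zero makes
    [eta] vanish at [b] as well as at [a], and homogeneity makes [e * eta] small in any norm. Two
    obstacles shape the details. [y] is derivable only almost everywhere and [derive1] takes a
    default value elsewhere, so [derive1] is additive in the perturbation only where [y] is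
    derivable, and that set must be measurable before integrals are split. Also, all data live on
    [[a, b]], while convolutions are handled for functions continuous on the whole line: [clamp a b]
    extends them. A sign bit treats left and right fractional integrals together, and exponent 0
    covers both [eta] itself and the primitive of [d2L]. *)

Lemma integral_nonneg_derivative (R : realType) (F f : R -> R) (c d : R) :
  c <= d -> continuous F ->
  (forall t, t \in `]c, d[ -> is_derive t (1 : R) F (f t)) ->
  (forall t, t \in `]c, d[ -> 0 <= f t) ->
  {in `]c, d[, continuous f} ->
  (\int[lebesgue_measure]_(t in `]c, d[) (f t)%:E = (F d - F c)%:E)%E.
Proof.
rewrite le_eqVlt => /predU1P[<- _ _ _ _|cd cF dF f0 cf].
  by rewrite set_itv_ge ?bnd_simp ?ltxx// integral_set0 subrr.
(* [f] may blow up at both endpoints, so the fundamental theorem is applied on [[c + h n, d - h n]]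
   and the limit is taken by monotone convergence. The factor 1/3 keeps these intervals
   nondegenerate already at [n = 0], where [harmonic] is 1. *)
pose h (n : nat) : R := (d - c) / 3 * harmonic n.
have h0 n : 0 < h n by rewrite mulr_gt0 ?divr_gt0 ?subr_gt0 ?harmonic_gt0.
have hle n : h n <= (d - c) / 3.
  rewrite ler_piMr// ?divr_ge0 ?subr_ge0 ?(ltW cd)//.
  by rewrite /harmonic/= invf_le1// ler1n.
have hmono n m : (n <= m)%N -> h m <= h n.
  move=> nm; rewrite ler_pM2l ?divr_gt0 ?subr_gt0//.
  by rewrite /harmonic/= lef_pV2 ?posrE// ler_nat.
have hcvg : h n @[n --> \oo] --> (0 : R).
  rewrite -[X in _ --> X](mulr0 ((d - c) / 3)).
  by apply: cvgM; [exact: cvg_cst|exact: cvg_harmonic].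
pose S n := [set` `[c + h n, d - h n]].
have SE : \bigcup_n S n = [set` `]c, d[].
  apply/seteqP; split => t /=.
    move=> [n _]; rewrite /S/= !in_itv/= => /andP[ct td].
    by have ? := h0 n; apply/andP; split; lra.
  rewrite in_itv/= => /andP[ct td].
  have [N _ HN] : \forall n \near \oo, h n < Num.min (t - c) (d - t).
    by apply: (cvgr_lt (0 : R) hcvg); rewrite lt_min !subr_gt0 ct td.
  exists N => //; rewrite /S/= in_itv/=.
  by have := HN N (leqnn _); rewrite /= lt_min => /andP[]; lra.
have Sitv n : S n `<=` [set` `]c, d[] by rewrite -SE; exact: bigcup_sup.
have cfS n : {within S n, continuous f}.
  apply: continuous_in_subspaceT => t /set_mem/Sitv; exact: cf.
have intS n : (\int[lebesgue_measure]_(t in S n) (f t)%:E =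
    (F (d - h n) - F (c + h n))%:E)%E.
  have hl : c + h n < d - h n by have := hle n; have := subr_gt0 c d; rewrite cd; lra.
  rewrite EFinB; apply: continuous_FTC2 => //; [exact: cfS| |]; last first.
    move=> t tin; have [dFt dEt] := dF t (Sitv n t (subset_itv_oo_cc tin)).
    by rewrite derive1E dEt.
  split.
  - by move=> t tin; have [] := dF t (Sitv n t (subset_itv_oo_cc tin)).
  - exact/cvg_at_right_filter/cF.
  - exact/cvg_at_left_filter/cF.
have lim1 : (\int[lebesgue_measure]_(t in S n) (f t)%:E @[n --> \oo] -->
    \int[lebesgue_measure]_(t in `]c, d[) (f t)%:E)%E.
  rewrite -SE; apply: ge0_nondecreasing_set_cvg_integral => //.
  - move=> n1 n2 nm; apply/subsetPset => t; rewrite /S/= !in_itv/= => /andP[].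
    by have := hmono _ _ nm; move=> ? ? ?; apply/andP; split; lra.
  - by move=> n1; exact: measurable_itv.
  - move=> n1; apply/measurable_EFinP.
    by apply: subspace_continuous_measurable_fun => //; exact: measurable_itv.
  - by move=> n1 t /Sitv/f0; rewrite lee_fin.
have lim2 : ((F (d - h n) - F (c + h n))%:E @[n --> \oo] --> (F d - F c)%:E)%E.
  apply: cvg_EFin; first by apply: nearW.
  apply: cvgB.
  - apply: continuous_cvg; first exact: cF.
    by rewrite -[X in _ --> X](subr0 d); apply: cvgB => //; exact: cvg_cst.
  - apply: continuous_cvg; first exact: cF.
    by rewrite -[X in _ --> X](addr0 c); apply: cvgD => //; exact: cvg_cst.
by move: lim1; rewrite (funext intS) => /cvg_unique; exact.
Qed.

(** The Abel kernel extended by 0 to [s <= 0]: every fractional integral is then taken over a fixed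
    interval, the dependence on [x] sitting in the kernel alone. For [g = 0] it is the indicator of
    the positive half-line. *)
Definition frac_ker (R : realType) (g s : R) : R :=
  if 0 < s then s `^ (- g) else 0.

(** The antiderivative of [frac_ker g] that vanishes for [s <= 0]; for [g < 1] it is continuous
    across the singularity at 0. *)
Definition frac_prim (R : realType) (g s : R) : R :=
  Num.max 0 s `^ (1 - g) / (1 - g).

Lemma frac_ker_ge0 (R : realType) (g s : R) : 0 <= frac_ker g s.
Proof. by rewrite /frac_ker; case: ifP => // _; exact: powR_ge0. Qed.

Lemma frac_ker_le0 (R : realType) (g s : R) : s <= 0 -> frac_ker g s = 0.
Proof. by rewrite /frac_ker; case: ltgtP. Qed.

Lemma measurable_frac_ker (R : realType) (g : R) :
  measurable_fun [set: R] (frac_ker g).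
Proof.
apply: measurable_fun_ifT; last exact: measurable_cst.
- by apply: measurable_fun_ltr; [exact: measurable_cst|exact: measurable_id].
- exact: measurable_powR.
Qed.

Lemma frac_prim_le0 (R : realType) (g s : R) : g < 1 -> s <= 0 ->
  frac_prim g s = 0.
Proof.
move=> g1 s0; rewrite /frac_prim max_l// powR0 ?mul0r//.
by rewrite subr_eq0 gt_eqF.
Qed.

Lemma continuous_powR_gt0 (R : realType) (p s : R) : 0 < s ->
  {for s, continuous (fun t : R => t `^ p)}.
Proof.
move=> s0; apply/differentiable_continuous/derivable1_diffP.
by apply: derivable_powR; rewrite in_itv/= s0.
Qed.

Lemma continuous_frac_prim (R : realType) (g : R) : g < 1 ->
  continuous (frac_prim g).
Proof.
move=> g1 s.
have [s0|s0|->] := ltgtP s 0.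
- apply: cvg_near_cst; near=> t; rewrite !frac_prim_le0// ltW//.
  by near: t; exact: lt_nbhsl.
- have : (fun t : R => t `^ (1 - g) / (1 - g)) t @[t --> s] --> frac_prim g s.
    rewrite /frac_prim max_r ?(ltW s0)//; apply: cvgMr_tmp.
    exact: continuous_powR_gt0.
  apply: cvg_trans; apply: near_eq_cvg; near=> t; rewrite /frac_prim max_r//.
  by apply/ltW; near: t; exact: lt_nbhsr.
- apply/left_right_continuousP; rewrite frac_prim_le0//; split.
    by apply: cvg_near_cst; near=> t; rewrite frac_prim_le0.
  have : (fun t : R => t `^ (1 - g) / (1 - g)) t @[t --> 0^'+] --> (0 : R).
    rewrite -[X in _ --> X](mul0r (1 - g)^-1).
    by apply: cvgMr_tmp; apply: powR_cvg0; rewrite subr_gt0.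
  by apply: cvg_trans; apply: near_eq_cvg; near=> t; rewrite /frac_prim max_r.
Unshelve. all: by end_near. Qed.

Lemma is_derive_frac_prim (R : realType) (g s : R) : g < 1 -> s != 0 ->
  is_derive s (1 : R) (frac_prim g) (frac_ker g s).
Proof.
move=> g1; have g1' : 1 - g != 0 by rewrite subr_eq0 gt_eqF.
rewrite neq_lt => /orP[s0|s0].
- rewrite (frac_ker_le0 _ (ltW s0)); apply: (@near_eq_is_derive _ R R (cst (0 : R))).
    near=> t; rewrite frac_prim_le0//; apply/ltW; near: t; exact: lt_nbhsl.
- apply: (@near_eq_is_derive _ _ _ (fun t => (1 - g)^-1 *: (t `^ (1 - g)))).
    near=> t; rewrite /frac_prim max_r 1?mulrC//.
    by apply/ltW; near: t; exact: lt_nbhsr.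
  have := is_deriveZ (1 - g)^-1 (is_derive1_powR (1 - g) s0).
  rewrite /frac_ker s0 scalerA mulVf// scale1r.
  by have -> : 1 - g - 1 = - g by ring.
Unshelve. all: by end_near. Qed.

Lemma continuous_frac_ker (R : realType) (g s : R) : s != 0 ->
  {for s, continuous (frac_ker g)}.
Proof.
rewrite neq_lt => /orP[s0|s0].
- apply: cvg_near_cst; near=> t; rewrite !frac_ker_le0// ltW//.
  by near: t; exact: lt_nbhsl.
- have : (fun t : R => t `^ (- g)) t @[t --> s] --> frac_ker g s.
    by rewrite /frac_ker s0; exact: continuous_powR_gt0.
  apply: cvg_trans; apply: near_eq_cvg; near=> t; rewrite /frac_ker ifT//.
  by near: t; exact: lt_nbhsr.
Unshelve. all: by end_near. Qed.

(** The kernel is nonnegative and has a continuous antiderivative, so [integral_nonneg_derivative]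
    applies on any interval that does not contain the singularity [x] in its interior. The outer
    sign undoes the derivative of the reflected argument. *)
Lemma integral_frac_ker (R : realType) (b : bool) (g c d x : R) :
  g < 1 -> c <= d ->
  (\int[lebesgue_measure]_(t in `[c, d]) (frac_ker g ((-1) ^+ b * (x - t)))%:E =
   ((-1) ^+ b * (frac_prim g ((-1) ^+ b * (x - c)) -
                 frac_prim g ((-1) ^+ b * (x - d))))%:E)%E.
Proof.
move=> g1.
pose F t := - (-1) ^+ b * frac_prim g ((-1) ^+ b * (x - t)).
pose f t := frac_ker g ((-1) ^+ b * (x - t)).
have caff : continuous (fun t : R => (-1) ^+ b * (x - t)).
  move=> t; apply: cvgMl_tmp; apply: cvgB; [exact: cvg_cst|exact: cvg_id].
have cF : continuous F.
  move=> t; apply: cvgMl_tmp; apply: continuous_cvg; last exact: caff.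
  exact: continuous_frac_prim.
have mf D : measurable_fun D (EFin \o f).
  apply: measurable_funTS; apply/measurable_EFinP.
  apply: (measurableT_comp (measurable_frac_ker g)).
  exact: continuous_measurable_fun.
have neq0 t : t != x -> (-1) ^+ b * (x - t) != 0.
  by move=> tx; rewrite mulf_neq0// ?signr_eq0// subr_eq0 eq_sym.
have main c' d' : c' <= d' -> x \notin `]c', d'[ ->
    (\int[lebesgue_measure]_(t in `[c', d']) (f t)%:E = (F d' - F c')%:E)%E.
  move=> cd xcd; rewrite -integral_itv_obnd_cbnd; last exact: mf.
  rewrite -integral_itv_bndo_bndc; last exact: mf.
  have tx t : t \in `]c', d'[ -> t != x by apply: contraTneq => ->.
  apply: integral_nonneg_derivative => //.
  - move=> t /tx/neq0 tn0.
    have h1 : is_derive t (1 : R) (fun t : R => (-1) ^+ b * (x - t)) (- (-1) ^+ b).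
      by apply: is_derive_eq; rewrite -[LHS]/(_ * _) add0r mul1r mulrN1.
    have := @is_derive1_comp R _ (fun t => (-1) ^+ b * (x - t)) _ _ _
      (is_derive_frac_prim g1 tn0) h1.
    move=> /(is_deriveZ (- (-1) ^+ b)) /is_derive_eq; apply.
    by rewrite -[LHS]/(_ * _) mulrCA mulrNN -expr2 sqrr_sign mulr1.
  - by move=> t _; exact: frac_ker_ge0.
  - move=> t /tx/neq0 tn0; apply: continuous_cvg; last exact: caff.
    exact: continuous_frac_ker.
have E c' d' : c' <= d' -> F d' - F c' = (-1) ^+ b * (frac_prim g ((-1) ^+ b * (x - c')) -
                 frac_prim g ((-1) ^+ b * (x - d'))).
  by move=> _; rewrite /F; ring.
move=> cd; rewrite -E//.
(* A singularity inside []c, d[] becomes an endpoint of both pieces after splitting at [x]; the two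
   contributions at [x] then cancel. *)
have [xin|xin] := boolP (x \in `]c, d[); last exact: main.
move: xin; rewrite in_itv/= => /andP[cx xd].
rewrite (@itv_bndbnd_setU _ _ _ (BLeft x)) ?bnd_simp ?(ltW cx) ?(ltW xd)//.
rewrite ge0_integral_setU//=; last 3 first.
- exact: mf.
- by move=> t _; rewrite lee_fin frac_ker_ge0.
- apply/disj_setPS => y [/=]; rewrite 2!in_itv/= => /andP[_ yx] /andP[].
  by rewrite leNgt yx.
rewrite integral_itv_bndo_bndc; last exact: mf.
rewrite main ?ltW// ?in_itv/= ?ltxx ?andbF// main ?ltW// ?in_itv/= ?ltxx//.
rewrite -EFinD; congr EFin; ring.
Qed.

(* [b = false] (resp. [true]) gives, up to the Gamma factor, the left (resp.
   right) fractional integral of order [1 - g] of [f] restricted to [c, d];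
   [g = 0] gives the ordinary primitives. *)
Definition frac_conv (R : realType) (b : bool) (g : R) (f : R -> R)
    (c d x : R) : R :=
  \int[lebesgue_measure]_(t in `[c, d]) (frac_ker g ((-1) ^+ b * (x - t)) * f t).

Lemma continuous_integrable_itv (R : realType) (f : R -> R) (c d : R) :
  continuous f -> lebesgue_measure.-integrable `[c, d] (EFin \o f).
Proof.
move=> cf; apply: continuous_compact_integrable; first exact: segment_compact.
exact: continuous_subspaceT.
Qed.

Lemma continuous_bounded_itv (R : realType) (f : R -> R) (c d : R) :
  continuous f -> exists2 M, 0 <= M & forall t, t \in `[c, d] -> `|f t| <= M.
Proof.
move=> cf; have [M [_ hM]] : bounded_set (f @` `[c, d]).
  apply: compact_bounded; apply: continuous_compact; last exact: segment_compact.
  exact: continuous_subspaceT.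
exists (`|M| + 1); first by rewrite addr_ge0.
move=> t tcd; apply: (hM (`|M| + 1)); last by exists t.
by rewrite (le_lt_trans (ler_norm M))// ltrDl.
Qed.

Lemma continuous_signed_sub (R : realType) (b : bool) (x : R) :
  continuous (fun t : R => (-1) ^+ b * (x - t)).
Proof. by move=> t; apply: cvgMl_tmp; apply: cvgB; [exact: cvg_cst|exact: cvg_id]. Qed.

Lemma measurable_frac_ker_sub (R : realType) (b : bool) (g x : R) (D : set R) :
  measurable_fun D (fun t => frac_ker g ((-1) ^+ b * (x - t))).
Proof.
apply: measurable_funTS; apply: (measurableT_comp (measurable_frac_ker g)).
apply: continuous_measurable_fun; exact: continuous_signed_sub.
Qed.

Lemma integrable_frac_ker (R : realType) (b : bool) (g c d x : R) : g < 1 ->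
  lebesgue_measure.-integrable `[c, d]
    (fun t => (frac_ker g ((-1) ^+ b * (x - t)))%:E).
Proof.
move=> g1; have [cd|dc] := leP c d; last first.
  by rewrite set_itv_ge ?bnd_simp -?ltNge//; exact: integrable_set0.
apply/integrableP; split.
  by apply/measurable_EFinP; exact: measurable_frac_ker_sub.
under eq_integral do rewrite /= ger0_norm ?frac_ker_ge0//.
by rewrite integral_frac_ker// ltry.
Qed.

Lemma integrable_mul_continuous (R : realType) (c d : R) (k f : R -> R) :
  lebesgue_measure.-integrable `[c, d] (EFin \o k) -> continuous f ->
  lebesgue_measure.-integrable `[c, d] (fun t => (k t * f t)%:E).
Proof.
move=> ik cf; have [M _ hM] := @continuous_bounded_itv R f c d cf.
apply: (integrableMl _ ik (h := f : measurableTypeR R -> R)).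
- exact: measurable_itv.
- by apply: measurable_funTS; exact: continuous_measurable_fun.
- exists M; split; first exact: num_real.
  by move=> M' MM' t tcd; exact: le_trans (hM _ tcd) (ltW MM').
Qed.

Lemma integrable_frac_conv (R : realType) (b : bool) (g c d x : R)
    (f : R -> R) : g < 1 -> continuous f ->
  lebesgue_measure.-integrable `[c, d]
    (fun t => (frac_ker g ((-1) ^+ b * (x - t)) * f t)%:E).
Proof.
by move=> g1; apply: integrable_mul_continuous; exact: integrable_frac_ker.
Qed.

Lemma Rintegral_frac_ker (R : realType) (b : bool) (g c d x : R) :
  g < 1 -> c <= d ->
  \int[lebesgue_measure]_(t in `[c, d]) (frac_ker g ((-1) ^+ b * (x - t))) =
   (-1) ^+ b * (frac_prim g ((-1) ^+ b * (x - c)) -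
                frac_prim g ((-1) ^+ b * (x - d))).
Proof. by move=> g1 cd; rewrite /Rintegral integral_frac_ker. Qed.

Lemma continuous_Rintegral_frac_ker (R : realType) (b : bool) (g c d : R) :
  g < 1 -> c <= d ->
  continuous (fun x =>
    \int[lebesgue_measure]_(t in `[c, d]) frac_ker g ((-1) ^+ b * (x - t))).
Proof.
move=> g1 cd; under eq_fun do rewrite Rintegral_frac_ker//.
have caff z : continuous (fun x : R => (-1) ^+ b * (x - z)).
  by move=> x; apply: cvgMl_tmp; apply: cvgB; [exact: cvg_id|exact: cvg_cst].
by move=> x; apply: cvgMl_tmp; apply: cvgB;
  apply: continuous_cvg; [exact: continuous_frac_prim|exact: caff
                         |exact: continuous_frac_prim|exact: caff].
Qed.

Lemma frac_ker_nincr (R : realType) (g s t : R) : 0 <= g -> 0 < s -> s <= t ->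
  frac_ker g t <= frac_ker g s.
Proof.
move=> g0 s0 st; rewrite /frac_ker s0 (lt_le_trans s0 st) !powRN.
rewrite lef_pV2 ?posrE ?powR_gt0 ?(lt_le_trans s0 st)//.
by apply: ge0_ler_powR; rewrite // nnegrE ltW// (lt_le_trans s0 st).
Qed.

(* The right-hand side has an explicit integral, unlike the left-hand side: this
   is what yields the Hoelder continuity of [frac_conv]. *)
Lemma dist_frac_ker (R : realType) (g u v : R) : 0 <= g -> u < v ->
  `|frac_ker g v - frac_ker g u| <=
    frac_ker g u - frac_ker g v + 2 * (if u <= 0 then frac_ker g v else 0).
Proof.
move=> g0 uv; have [u0|u0] := leP u 0.
  rewrite (frac_ker_le0 _ u0) subr0 ger0_norm ?frac_ker_ge0//; lra.
by rewrite distrC ger0_norm ?subr_ge0 ?mulr0 ?addr0// frac_ker_nincr// ltW.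
Qed.

(** Strictly between [x] and [y] the kernel at [y] is already positive while the kernel at [x] is
    still 0: this is where the extra term of [dist_frac_ker] lives. Integrating over the whole
    segment instead of its part in [[c, d]] gives a bound that depends on the distance only.
    [Num.min] and [Num.max] are there because the reflection reverses the order of [x] and [y]. *)
Lemma Rintegral_frac_ker_between (R : realType) (b : bool) (g c d x y : R) :
  g < 1 -> c <= d -> (-1) ^+ b * x < (-1) ^+ b * y ->
  \int[lebesgue_measure]_(t in `[c, d])
    ((fun t => frac_ker g ((-1) ^+ b * (y - t))) \_ `[Num.min x y, Num.max x y]) t
  <= frac_prim g ((-1) ^+ b * (y - x)).
Proof.
move=> g1 cd xy; set J := [set` `[Num.min x y, _]].
have mJ : lebesgue_measure.-integrable J
    (fun t => (frac_ker g ((-1) ^+ b * (y - t)))%:E) by exact: integrable_frac_ker.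
have -> : frac_prim g ((-1) ^+ b * (y - x)) =
    \int[lebesgue_measure]_(t in J) frac_ker g ((-1) ^+ b * (y - t)).
  rewrite Rintegral_frac_ker; [|by []|by rewrite ge_min le_max !lexx].
  case: b xy {mJ}; rewrite !(expr0, expr1, mul1r, mulN1r) => xy.
    rewrite ltrN2 in xy; rewrite min_r ?max_l ?(ltW xy)// subrr oppr0.
    by rewrite (frac_prim_le0 g1 (lexx _)) sub0r opprK.
  by rewrite min_l ?max_r ?(ltW xy)// subrr (frac_prim_le0 g1 (lexx _)) subr0.
rewrite -Rintegral_mkcondr; apply: fine_le.
- apply: integrable_fin_num; first by apply: measurableI; exact: measurable_itv.
  apply: (integrableS _ _ _ mJ); first exact: measurable_itv.
    by apply: measurableI; exact: measurable_itv.
  exact: subIsetr.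
- by apply: integrable_fin_num => //; exact: measurable_itv.
- apply: ge0_subset_integral => //.
  + by apply: measurableI; exact: measurable_itv.
  + exact: measurable_itv.
  + by have /integrableP[] := mJ.
  + by move=> t _; rewrite lee_fin frac_ker_ge0.
Qed.

(** Obtained by integrating [dist_frac_ker] against [f], bounded by [M]. The two kernel integrals
    and [frac_prim] on the right are all explicit, so continuity in [x] can be read off. *)
Lemma dist_frac_conv (R : realType) (b : bool) (g c d x y M : R) (f : R -> R) :
  0 <= g < 1 -> c <= d -> continuous f ->
  (forall t, t \in `[c, d] -> `|f t| <= M) ->
  (-1) ^+ b * x < (-1) ^+ b * y ->
  `|frac_conv b g f c d y - frac_conv b g f c d x| <=
  M * (\int[lebesgue_measure]_(t in `[c, d]) frac_ker g ((-1) ^+ b * (x - t)) -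
       \int[lebesgue_measure]_(t in `[c, d]) frac_ker g ((-1) ^+ b * (y - t)) +
       2 * frac_prim g ((-1) ^+ b * (y - x))).
Proof.
move=> /andP[g0 g1] cd cf fM xy.
have M0 : 0 <= M by apply: le_trans (fM c _); rewrite ?in_itv/= ?lexx.
set q := (fun t => frac_ker g ((-1) ^+ b * (y - t))) \_ `[Num.min x y, Num.max x y].
have ik z := integrable_frac_ker b c d z g1.
have ic z := integrable_frac_conv b c d z g1 cf.
have mcd : measurable ([set` `[c, d]] : set (measurableTypeR R)).
  exact: measurable_itv.
have iq : lebesgue_measure.-integrable `[c, d] (EFin \o q).
  rewrite /q -restrict_EFin; apply/integrable_restrict => //.
  apply: (integrableS _ _ _ (ik y)) => //.
  by apply: measurableI => //; exact: measurable_itv.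
pose p t := frac_ker g ((-1) ^+ b * (x - t)) - frac_ker g ((-1) ^+ b * (y - t)).
pose r t := p t + 2 * q t.
pose h t := frac_ker g ((-1) ^+ b * (y - t)) * f t -
  frac_ker g ((-1) ^+ b * (x - t)) * f t.
have i1 : lebesgue_measure.-integrable `[c, d] (EFin \o p).
  exact (integrableB mcd (ik x) (ik y)).
have iqq : lebesgue_measure.-integrable `[c, d] (EFin \o (fun t => 2 * q t)).
  exact (integrableZl mcd 2 iq).
have i2 : lebesgue_measure.-integrable `[c, d] (EFin \o r).
  exact (integrableD mcd i1 iqq).
have i3 : lebesgue_measure.-integrable `[c, d] (EFin \o (fun t => M * r t)).
  exact (integrableZl mcd M i2).
have i4 : lebesgue_measure.-integrable `[c, d] (EFin \o h).
  exact (integrableB mcd (ic y) (ic x)).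
have i5 : lebesgue_measure.-integrable `[c, d] (EFin \o (fun t => `|h t|)).
  exact (integrable_norm i4).
rewrite /frac_conv -(RintegralB mcd (ic y) (ic x)).
apply: le_trans; first exact: (le_normr_Rintegral mcd i4).
apply: (@le_trans _ _ (M * (\int[lebesgue_measure]_(t in `[c, d]) r t))).
  rewrite -(RintegralZl _ mcd i2).
  apply: (le_Rintegral mcd i5 i3) => t tcd; rewrite /h /r /p.
  rewrite -mulrBl normrM mulrC; apply: ler_pM => //; first exact: fM.
  apply: le_trans; first apply: dist_frac_ker => //.
    by rewrite !mulrBr ltrD2r.
  (* The conditional term of [dist_frac_ker] is nonzero only if the kernel at [x] vanishes and the
     one at [y] does not, and then [t] lies in the segment on which [q] is the kernel. *)
  rewrite lerD2l ler_pM2l// /q patchE.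
  case: ifPn => u0; last by case: ifPn => // _; exact: frac_ker_ge0.
  have [v0|v0] := leP ((-1) ^+ b * (y - t)) 0.
    by rewrite frac_ker_le0//; case: ifPn.
  rewrite ifT// inE/= in_itv/= ge_min le_max.
  case: b u0 v0 {ik ic iq i1 iqq i2 i3 i4 i5 q p r h xy};
    rewrite !(expr0, expr1, mul1r, mulN1r) => u0 v0.
    have -> : y <= t by lra.
    have -> : t <= x by lra.
    by rewrite orbT.
  have -> : x <= t by lra.
  have -> : t <= y by lra.
  by rewrite orbT.
rewrite ler_wpM2l// (RintegralD mcd i1 iqq).
rewrite (RintegralB mcd (ik x) (ik y)) lerD2l (RintegralZl _ mcd iq) ler_pM2l//.
exact: Rintegral_frac_ker_between.
Qed.

Lemma continuous_frac_conv (R : realType) (b : bool) (g c d : R) (f : R -> R) :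
  0 <= g < 1 -> c <= d -> continuous f -> continuous (frac_conv b g f c d).
Proof.
move=> g01 cd cf; have [M M0 fM] := @continuous_bounded_itv R f c d cf.
have g1 : g < 1 by case/andP: g01.
move=> x; apply/cvgrPdist_le => e e0.
pose I z := \int[lebesgue_measure]_(t in `[c, d]) frac_ker g ((-1) ^+ b * (z - t)).
have cI : continuous I by move=> z; exact: continuous_Rintegral_frac_ker.
(* The absolute values make the bound symmetric, so the order of the reflected points, which
   [dist_frac_conv] prescribes, no longer matters. *)
have bound y : `|frac_conv b g f c d x - frac_conv b g f c d y| <=
    M * (`|I x - I y| + 2 * frac_prim g `|x - y|).
  have bound1 u v : (-1) ^+ b * u < (-1) ^+ b * v ->
      `|frac_conv b g f c d v - frac_conv b g f c d u| <=
      M * (`|I u - I v| + 2 * frac_prim g `|u - v|).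
    move=> uv; apply: le_trans; first exact: (dist_frac_conv g01 cd cf fM uv).
    rewrite ler_wpM2l// lerD ?ler_norm// ler_wpM2l// (distrC u).
    have -> : `|v - u| = (-1) ^+ b * (v - u); last by [].
    by rewrite -[LHS](normrMsign b) ger0_norm// mulrBr subr_ge0 ltW.
  have [xy|xy|xy] := ltgtP ((-1) ^+ b * x) ((-1) ^+ b * y).
  - by rewrite distrC; exact: bound1.
  - by rewrite (distrC (I x)) (distrC x); exact: bound1.
  - have -> : x = y by apply: (mulfI _ xy); rewrite signr_eq0.
    by rewrite !subrr normr0 mulr_ge0// addr_ge0// mulr_ge0// frac_prim_le0.
have lim0 : M * (`|I x - I y| + 2 * frac_prim g `|x - y|) @[y --> x] --> (0 : R).
  have -> : 0 = M * (`|I x - I x| + 2 * frac_prim g `|x - x|).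
    by rewrite !subrr normr0 frac_prim_le0// mulr0 addr0 mulr0.
  apply: cvgMl_tmp; apply: cvgD.
    by apply: cvg_norm; apply: cvgB; [exact: cvg_cst|exact: cI].
  apply: cvgMl_tmp; apply: continuous_cvg; first exact: continuous_frac_prim.
  by apply: cvg_norm; apply: cvgB; [exact: cvg_cst|exact: cvg_id].
near=> y; apply: le_trans (bound y) _.
near: y; exact: (cvgr_le _ lim0).
Unshelve. all: by end_near. Qed.

(** Fractional integration by parts. Fubini exchanges the variables, which changes the sign of the
    argument of the kernel: a left fractional integral of [f] becomes a right one of [G] and
    conversely, hence [~~ b]. *)
Lemma Rintegral_mul_frac_conv (R : realType) (b : bool) (g A B c d : R)
    (G f : R -> R) : 0 <= g < 1 -> c <= d -> A <= B ->
  continuous G -> continuous f ->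
  \int[lebesgue_measure]_(x in `[A, B]) (G x * frac_conv b g f c d x) =
  \int[lebesgue_measure]_(t in `[c, d]) (f t * frac_conv (~~ b) g G A B t).
Proof.
move=> g01 cd AB cG cf; have g1 : g < 1 by case/andP: g01.
(* Extension by 0 outside the two intervals turns both sides into iterated integrals over the whole
   plane. *)
pose f' : measurableTypeR R -> R := f \_ `[c, d].
pose G' : measurableTypeR R -> R := G \_ `[A, B].
pose F (z : measurableTypeR R * measurableTypeR R) : R :=
  G' z.1 * (frac_ker g ((-1) ^+ b * (z.1 - z.2)) * f' z.2).
have meas_patch (h : R -> R) (u v : R) : continuous h ->
    measurable_fun setT (h \_ `[u, v] : measurableTypeR R -> R).
  move=> ch; apply/(measurable_restrictT _ _).1; first exact: measurable_itv.
  by apply: measurable_funTS; exact: continuous_measurable_fun.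
have mF : measurable_fun setT F.
  apply: measurable_funM.
    by apply: measurableT_comp; [exact: meas_patch|exact: measurable_fst].
  apply: measurable_funM; last first.
    by apply: measurableT_comp; [exact: meas_patch|exact: measurable_snd].
  apply: (measurableT_comp (measurable_frac_ker g)).
  apply: measurable_funM; first exact: measurable_cst.
  by apply: measurable_funB; [exact: measurable_fst|exact: measurable_snd].
have inner (b' : bool) (h k : R -> R) u v u' v' x : continuous h ->
    (\int[lebesgue_measure]_t
      ((k \_ `[u', v']) x * (frac_ker g ((-1) ^+ b' * (x - t)) * (h \_ `[u, v]) t))%:E =
     ((k \_ `[u', v']) x * frac_conv b' g h u v x)%:E)%E.
  move=> ch; move: ((k \_ `[u', v']) x) => r.
  have mD : measurable ([set` `[u, v]] : set (measurableTypeR R)).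
    exact: measurable_itv.
  have ic := integrable_frac_conv b' u v x g1 ch.
  rewrite [LHS](_ : _ = \int[lebesgue_measure]_(t in `[u, v])
    (r%:E * (frac_ker g ((-1) ^+ b' * (x - t)) * h t)%:E))%E.
    rewrite (integralZl mD ic) EFinM; congr (_ * _)%E.
    by rewrite fineK//; exact: (integrable_fin_num mD ic).
  rewrite [RHS]integral_mkcond; apply: eq_integral => t _.
  rewrite !patchE -EFinM; case: ifPn => // _.
  by rewrite [X in _ * (_ * X)](_ : _ = 0)// !mulr0.
have outer (h k : R -> R) (u v : R) :
    (\int[lebesgue_measure]_x ((h \_ `[u, v]) x * k x)%:E =
     \int[lebesgue_measure]_(x in `[u, v]) (h x * k x)%:E)%E.
  rewrite [RHS]integral_mkcond; apply: eq_integral => t _.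
  by rewrite !patchE; case: ifPn => // _; rewrite mul0r.
(* Tonelli: with absolute values the inner integral is a [frac_conv] of the absolute value of [f], a
   continuous function of [x], so the outer integral over [[A, B]] is finite. *)
have iF : (lebesgue_measure \x lebesgue_measure)%E.-integrable setT (EFin \o F).
  apply/integrable12ltyP; first exact/measurable_EFinP.
  have cnf : continuous (fun t => `|f t|).
    by move=> t; apply: cvg_norm; exact: cf.
  rewrite [ltLHS](_ : _ = \int[lebesgue_measure]_x
      (((fun z => `|G z|) \_ `[A, B]) x *
        frac_conv b g (fun z => `|f z|) c d x)%:E)%E.
    rewrite outer.
    have ci : continuous (fun x => `|G x| * frac_conv b g (fun z => `|f z|) c d x).
      move=> x; apply: cvgM; first by apply: cvg_norm; exact: cG.
      exact: continuous_frac_conv.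
    apply: integrable_lty; first exact: measurable_itv.
    exact: continuous_integrable_itv.
  apply: eq_integral => x _; rewrite -inner//.
  apply: eq_integral => t _; rewrite /F /= !normrM; congr (_ * (_ * _))%:E.
  - by rewrite /G' !patchE; case: ifPn => // _; rewrite normr0.
  - by rewrite ger0_norm// frac_ker_ge0.
  - by rewrite /f' !patchE; case: ifPn => // _; rewrite normr0.
congr fine; rewrite -!outer.
transitivity (\int[lebesgue_measure]_x \int[lebesgue_measure]_t (F (x, t))%:E)%E.
  by apply: eq_integral => x _; rewrite -inner.
rewrite (Fubini iF); apply: eq_integral => t _.
rewrite -inner//; apply: eq_integral => x _; rewrite /F/=; congr EFin.
have -> : (-1) ^+ (~~ b) * (t - x) = (-1) ^+ b * (x - t) :> R.
  by rewrite signrN mulNr -mulrN opprB.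
by rewrite mulrCA mulrC -mulrA mulrCA (mulrC (G' x)).
Qed.

(** [Gamma] is a real-valued integral, which would be 0 if the extended one were infinite, so
    finiteness has to be proved along with positivity. The integrand is dominated by the Abel kernel
    on []0, 1]] and by the exponential density beyond 1; on []0, 1]] it is at least [expR (- 1)]. *)
Lemma Gamma_frac_gt0 (R : realType) (g : R) : 0 <= g < 1 -> 0 < Gamma (1 - g).
Proof.
move=> /andP[g0 g1].
pose h (t : measurableTypeR R) : R := t `^ (1 - g - 1) * expR (- t).
have hE : 1 - g - 1 = - g by ring.
have m0y : measurable ([set` `]0, +oo[] : set (measurableTypeR R)).
  exact: measurable_itv.
have m01 : measurable ([set` `]0, 1]] : set (measurableTypeR R)).
  exact: measurable_itv.
have mh D : measurable_fun D h.
  apply: measurable_funTS; apply: measurable_funM; first exact: measurable_powR.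
  apply: (measurableT_comp (@measurable_expR R));
  by apply: continuous_measurable_fun; exact: opp_continuous.
have ik : lebesgue_measure.-integrable `]0, +oo[
    (EFin \o ((frac_ker g : measurableTypeR R -> R) \_ `[0, 1])).
  rewrite -restrict_EFin; apply/integrable_restrict; [exact: measurable_itv|by []|].
  have -> : EFin \o (frac_ker g : measurableTypeR R -> R) =
      fun t => (frac_ker g ((-1) ^+ true * (0 - t)))%:E.
    by apply/funext => t /=; rewrite expr1 mulN1r sub0r opprK.
  apply: integrableS (integrable_frac_ker true 0 1 0 g1);
    [exact: measurable_itv| |exact: subIsetr].
  by apply: measurableI => //; exact: measurable_itv.
have ie : lebesgue_measure.-integrable `]0, +oo[
    (EFin \o (exponential_pdf 1 : measurableTypeR R -> R)).
  apply: integrableS (integrable_exponential_pdf (ltr01 : 0 < (1 : R))) => //.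
have ih : lebesgue_measure.-integrable `]0, +oo[ (EFin \o h).
  apply: (le_integrable m0y _ _ (integrableD m0y ik ie)).
    by apply/measurable_EFinP; exact: mh.
  move=> t /=; rewrite in_itv/= andbT => t0.
  have h0 : 0 <= h t by rewrite mulr_ge0 ?powR_ge0 ?expR_ge0.
  have e0 : 0 <= exponential_pdf 1 t by exact: exponential_pdf_ge0.
  rewrite lee_fin (ger0_norm h0); apply: le_trans (ler_norm _).
  have eE : exponential_pdf 1 t = expR (- t).
    by rewrite exponential_pdfE ?ltW// mul1r mulN1r.
  have [t1|t1] := leP t 1.
    rewrite patchE ifT ?inE/= ?in_itv/= ?(ltW t0)//.
    rewrite -[leLHS]addr0 lerD// /h hE /frac_ker t0 ler_piMr ?powR_ge0//.
    by rewrite expR_le1 oppr_le0 ltW.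
  rewrite -[leLHS]add0r lerD//.
    by rewrite patchE; case: ifPn => // _; exact: frac_ker_ge0.
  rewrite eE /h hE ler_piMl ?expR_ge0//.
  by rewrite powRN invf_le1 ?powR_gt0// -(powRr0 t) ler_powR// ltW.
have e1 : (0%:E < \int[lebesgue_measure]_(t in `]0%R, +oo[) (h t)%:E)%E.
  apply: (@lt_le_trans _ _ (\int[lebesgue_measure]_(t in `]0%R, 1%R]) (expR (- 1))%:E)%E).
    rewrite integral_cst//= lebesgue_measure_itv/= lte_fin ltr01 oppr0 adde0 mule1.
    by rewrite lte_fin expR_gt0.
  apply: (@le_trans _ _ (\int[lebesgue_measure]_(t in `]0%R, 1%R]) (h t)%:E)%E).
    apply: ge0_le_integral => //.
    - by apply/measurable_EFinP; exact: mh.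
    - move=> t /=; rewrite in_itv/= => /andP[t0 t1]; rewrite lee_fin /h hE.
      apply: (@le_trans _ _ (expR (- t))); first by rewrite ler_expR lerN2.
      rewrite ler_peMl ?expR_ge0// powRN invf_ge1 ?powR_gt0//.
      by rewrite -(powRr0 t) ger_powR ?t0.
  apply: ge0_subset_integral => //.
  - by apply/measurable_EFinP; exact: mh.
  - by move=> t _; rewrite lee_fin mulr_ge0 ?powR_ge0 ?expR_ge0.
  - by apply: subset_itvl.
rewrite -lte_fin /Gamma /Rintegral fineK//.
exact: (integrable_fin_num m0y ih).
Qed.

(** * Perturbations in the Caputo space *)

(* The derivability set of a continuous function is Borel: by the Cauchy
   criterion it is a countable intersection of countable unions of closed
   sets. *)
Lemma measurable_derivable_set (R : realType) (f : R -> R) : continuous f ->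
  measurable ([set t | derivable f t 1] : set (measurableTypeR R)).
Proof.
move=> cf.
pose Q (h t : R) : R := h^-1 * (f (h + t) - f t).
pose P m : set (R * R) :=
  [set hk | [/\ hk.1 != 0, hk.2 != 0, `|hk.1| < m.+1%:R^-1 & `|hk.2| < m.+1%:R^-1]].
pose C n m := \bigcap_(hk in P m) [set t | `|Q hk.1 t - Q hk.2 t| <= n.+1%:R^-1].
have cQ h : continuous (Q h).
  move=> t; apply: cvgMl_tmp; apply: cvgB; last exact: cf.
  apply: continuous_cvg; first exact: cf.
  by apply: cvgD; [exact: cvg_cst|exact: cvg_id].
have clC n m : closed (C n m).
  apply: closed_bigI => hk _.
  have := @closed_le R n.+1%:R^-1; apply: closed_comp => t _.
  by apply: cvg_norm; apply: cvgB; exact: cQ.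
have derE t : (derivable f t 1) = (cvg (Q h t @[h --> 0^'])).
  rewrite /derivable.
  have -> // : (fun h => h^-1 *: ((f \o shift t) (h *: (1 : R)) - f t)) = Q^~ t.
  by apply/funext => h; rewrite /Q /= [_%:A]mulr1.
suff -> : [set t | derivable f t 1] = \bigcap_n \bigcup_m C n m.
  apply: bigcap_measurableType => n _; apply: bigcup_measurable => m _.
  exact: closed_measurable.
apply/seteqP; split => t /=; rewrite derE.
- move=> /cvg_ex[l /cvgrPdist_lt hl] n _.
  have n0 : 0 < n.+1%:R^-1 / 2 :> R by rewrite divr_gt0.
  have := hl _ n0 => /nbhs_ballP[d /= d0 hd].
  have [m hm] : exists m : nat, m.+1%:R^-1 < d.
    by exists (Num.truncn d^-1); rewrite invf_plt ?posrE// truncnS_gt.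
  exists m => // -[h k] [/= h0 k0 hm' km'].
  have hh : `|l - Q h t| < n.+1%:R^-1 / 2.
    by apply: hd => //; rewrite /ball/= sub0r normrN (lt_trans hm').
  have kk : `|l - Q k t| < n.+1%:R^-1 / 2.
    by apply: hd => //; rewrite /ball/= sub0r normrN (lt_trans km').
  have -> : Q h t - Q k t = (l - Q k t) - (l - Q h t) by ring.
  by rewrite (le_trans (ler_normB _ _))// [leRHS]splitr lerD// ltW.
- move=> hC; apply: cauchy_cvg; apply: cauchy_exP => e e0.
  have [n hn] : exists n : nat, n.+1%:R^-1 < e.
    by exists (Num.truncn e^-1); rewrite invf_plt ?posrE// truncnS_gt.
  have [m _ hm] := hC n Logic.I.
  (* One fixed admissible increment serves as reference: all difference quotients with increments
     below the radius are close to the quotient at [k], which is the center required by the Cauchy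
     criterion. *)
  pose k : R := m.+1%:R^-1 / 2.
  have m0 : 0 < m.+1%:R^-1 :> R by [].
  exists (Q k t); apply/nbhs_ballP; exists m.+1%:R^-1 => // h /=.
  rewrite /ball/= sub0r normrN => hm1 h0.
  have := hm (k, h); rewrite /P/=; move=> /(_ _)/le_lt_trans; apply => //.
  have k0 : 0 < k by rewrite divr_gt0.
  split => //; first by rewrite gt_eqF.
  by rewrite gtr0_norm// /k ltr_pdivrMr// ltr_pMr// ltr1n.
Qed.

Lemma derive1_not_derivable (R : realType) (f : R -> R) (t : R) :
  ~ derivable f t 1 -> derive1 f t = point.
Proof. by move=> ndf; rewrite derive1E /derive; exact: dvgP. Qed.

(* Where [f] is not derivable, both [derive1]s are the junk value [point]: hence
   the indicator. *)
Lemma derive1_perturb (R : realType) (f k : R -> R) (e t dk : R) :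
  is_derive t (1 : R) k dk ->
  derive1 (fun x => f x + e * k x) t =
    derive1 f t + e * (dk * (t \in [set u | derivable f u 1])%:R).
Proof.
move=> [kt kE].
have ekt : derivable (fun x => e * k x) t 1 by exact: derivableZ.
have [ft|nft] := pselect (derivable f t 1).
  rewrite mem_set// mulr1 !derive1E.
  rewrite (_ : (fun x => _) = f + (fun x => e * k x))// deriveD//; congr (_ + _).
  by rewrite (_ : (fun x => _) = e \*: k)// deriveZ// kE.
have nzt : ~ derivable (fun x => f x + e * k x) t 1.
  move=> zt; apply: nft; have := derivableB zt ekt; rewrite (_ : _ - _ = f)//.
  by apply/funext => x /=; rewrite -[LHS]/(_ + _ - _) addrK.
rewrite (@memNset _ [set u | derivable f u 1] t nft) !mulr0 addr0.
by rewrite (derive1_not_derivable nzt) (derive1_not_derivable nft).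
Qed.

Lemma is_derive_primitive (R : realType) (g : R -> R) (a t : R) :
  continuous g -> a < t ->
  is_derive t (1 : R) (fun x => \int[lebesgue_measure]_(s in `[a, x]) g s) (g t).
Proof.
move=> cg at_; have ttu : t < t + 1 by rewrite ltrDl.
have [dF FE] := continuous_FTC1_closed ttu (continuous_integrable_itv a (t + 1) cg) at_ (cg t).
split; first exact: dF.
by rewrite -derive1E; exact: FE.
Qed.

(** The projection of the line onto [[a, b]]. Composing with it turns a function continuous on
    [[a, b]] into one continuous everywhere with the same values on [[a, b]]. *)
Definition clamp (R : realType) (a b x : R) : R := Num.max a (Num.min b x).

Lemma clamp_id (R : realType) (a b x : R) : x \in `[a, b] -> clamp a b x = x.
Proof. by rewrite in_itv/= /clamp => /andP[ax xb]; rewrite min_r// max_r. Qed.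

Lemma clamp_itv (R : realType) (a b x : R) : a <= b -> clamp a b x \in `[a, b].
Proof. by move=> ab; rewrite in_itv/= /clamp le_max lexx ge_max ab ge_min lexx. Qed.

Lemma continuous_clamp (R : realType) (a b : R) : continuous (@clamp R a b).
Proof.
move=> x; apply: (@continuous_max _ _ (cst a) (fun x => Num.min b x)).
  exact: cvg_cst.
apply: (@continuous_min _ _ (cst b) id); [exact: cvg_cst|exact: cvg_id].
Qed.

Lemma within_continuous_clamp (R : realType) (a b : R) (f : R -> R) : a <= b ->
  {within `[a, b], continuous f} -> continuous (f \o clamp a b).
Proof.
move=> ab /subspace_continuousP cf x.
have := cf _ (clamp_itv x ab); apply: cvg_comp.
move=> U /= hU.
have : \forall y \near x, `[a, b]%classic (clamp a b y) -> U (clamp a b y).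
  exact: (@continuous_clamp R a b x [set u | `[a, b]%classic u -> U u] hU).
by apply: filterS => y; apply; exact: clamp_itv.
Qed.

Lemma abs_continuous_within (R : realType) (a b : R) (f : R -> R) :
  abs_continuous a b f -> {within `[a, b], continuous f}.
Proof.
move=> acf; apply/subspace_continuousP => x /= xab.
apply/cvgrPdist_lt => e e0; have [d d0 hd] := acf e e0.
have key u v : u \in `[a, b] -> v \in `[a, b] -> u <= v -> v - u < d ->
    `|f v - f u| < e.
  rewrite !in_itv/= => /andP[au ub] /andP[av vb] uv uvd.
  (* Absolute continuity is used with a single interval. *)
  have := hd 1%N (fun=> u) (fun=> v); rewrite !big_ord1; apply => //.
  by apply/trivIsetP => i j _ _; rewrite !ord1.
rewrite near_withinE; apply/nbhs_ballP; exists d => // y /=.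
rewrite /ball/= => xyd yab; have [xy|yx] := leP x y.
  rewrite distrC; apply: key => //.
  by rewrite -(ger0_norm (_ : 0 <= y - x)) ?subr_ge0// distrC.
apply: key => //; first exact: ltW.
by rewrite -(ger0_norm (_ : 0 <= x - y)) ?subr_ge0// ltW.
Qed.

(** Derivability is local, so on the open interval [f] can be replaced by its continuous extension
    [f \o clamp a b], to which [measurable_derivable_set] applies. *)
Lemma measurable_derivable_itv (R : realType) (a b : R) (f : R -> R) : a < b ->
  {within `[a, b], continuous f} ->
  measurable ([set t | (t \in `]a, b[) /\ derivable f t 1] :
              set (measurableTypeR R)).
Proof.
move=> ab cf.
have -> : [set t | (t \in `]a, b[) /\ derivable f t 1] =
    `]a, b[%classic `&` [set t | derivable (f \o clamp a b) t 1].
  have eqn t : t \in `]a, b[ -> \forall s \near t, f s = (f \o clamp a b) s.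
    move=> tab; near=> s; rewrite /= clamp_id//; apply: subset_itv_oo_cc.
    by near: s; exact: near_in_itvoo.
  apply/seteqP; split => t /= [tab dt]; split => //.
    exact: near_eq_derivable (eqn _ tab) dt.
  apply: near_eq_derivable dt; near=> s; apply/esym.
  by near: s; exact: eqn.
apply: measurableI; first exact: measurable_itv.
by apply: measurable_derivable_set; apply: within_continuous_clamp => //; exact: ltW.
Unshelve. all: by end_near. Qed.

Lemma integrable_itv_oo_cc (R : realType) (c d : R) (f : R -> R) :
  lebesgue_measure.-integrable `]c, d[ (EFin \o f) ->
  lebesgue_measure.-integrable `[c, d] (EFin \o f).
Proof.
move=> /integrableP[mf iy]; have mf' := emeasurable_fun_itv_cc mf.
apply/integrableP; split => //.
rewrite -integral_itv_obnd_cbnd; last first.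
  by apply: measurableT_comp => //; apply/emeasurable_fun_itv_bndo_bndcP.
by rewrite -integral_itv_bndo_bndc//; exact: measurableT_comp.
Qed.

Lemma Rintegral_itv_oo_cc (R : realType) (c d : R) (f : R -> R) :
  lebesgue_measure.-integrable `[c, d] (EFin \o f) ->
  \int[lebesgue_measure]_(t in `]c, d[) f t =
  \int[lebesgue_measure]_(t in `[c, d]) f t.
Proof.
move=> fi; rewrite Rintegral_itv_bndo_bndc; last first.
  apply: (integrableS _ _ _ fi); [exact: measurable_itv|exact: measurable_itv|].
  exact: subset_itv_oo_cc.
rewrite Rintegral_itv_obnd_cbnd//.
apply: (integrableS _ _ _ fi); [exact: measurable_itv|exact: measurable_itv|].
exact: subset_itv_oc_cc.
Qed.

(** [w] stands for an Abel kernel. The pointwise formula for [derive1 z] carries the indicator of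
    the set [D] where [f] is derivable: measurability of [D] makes each summand integrable, and
    since almost every point of the interval is in [D], the indicator disappears from the
    integral. *)
Lemma Rintegral_derive1_perturb (R : realType) (a b c d e : R)
    (w f k g : R -> R) : a < b -> a <= c -> d <= b ->
  {within `[a, b], continuous f} ->
  {ae lebesgue_measure, forall t : R, t \in `]a, b[ -> derivable f t 1} ->
  (forall t, t \in `]a, b[ -> is_derive t (1 : R) k (g t)) ->
  lebesgue_measure.-integrable `[c, d] (EFin \o (fun t => w t * derive1 f t)) ->
  lebesgue_measure.-integrable `[c, d] (EFin \o (fun t => w t * g t)) ->
  let z x := f x + e * k x in
  lebesgue_measure.-integrable `[c, d] (EFin \o (fun t => w t * derive1 z t)) /\
  \int[lebesgue_measure]_(t in `[c, d]) (w t * derive1 z t) =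
  \int[lebesgue_measure]_(t in `[c, d]) (w t * derive1 f t) +
  e * \int[lebesgue_measure]_(t in `[c, d]) (w t * g t).
Proof.
move=> ab ac db cf aef dk fi gi z.
pose D : set (measurableTypeR R) := [set t | (t \in `]a, b[) /\ derivable f t 1].
have mD : measurable D by exact: measurable_derivable_itv.
have mcd : measurable ([set` `[c, d]] : set (measurableTypeR R)).
  exact: measurable_itv.
pose gD (t : measurableTypeR R) : R := w t * g t * \1_D t.
have gDi : lebesgue_measure.-integrable `[c, d] (EFin \o gD).
  apply: (integrableMl mcd gi (h := \1_D : measurableTypeR R -> R)).
    by apply: measurable_funTS; exact: measurable_indic.
  exists 1; split => // M M1 t _ /=; apply: le_trans (ltW M1).
  by rewrite indicE; case: (t \in D); rewrite ?normr1 ?normr0.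
have egDi : lebesgue_measure.-integrable `[c, d] (EFin \o (fun t => e * gD t)).
  exact (integrableZl mcd e gDi).
(* Derivatives are controlled only inside []a, b[]; at [a] and [b] the value of [derive1] depends on
   the functions outside [[a, b]]. The pointwise identity is therefore proved on []c, d[] and
   carried to [[c, d]] by ignoring two points. *)
have oo t : t \in `]c, d[ -> t \in `]a, b[.
  by rewrite !in_itv/= => /andP[ct td]; rewrite (le_lt_trans ac ct) (lt_le_trans td db).
have zE t : t \in `]c, d[ -> w t * derive1 z t = w t * derive1 f t + e * gD t.
  move=> tcd; have tab := oo _ tcd; rewrite /z (derive1_perturb _ _ (dk t tab)) /gD indicE.
  have -> : (t \in D) = (t \in [set u | derivable f u 1]).
    by apply/idP/idP; rewrite !inE/=; [case|].
  by ring.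
pose s t := w t * derive1 f t + e * gD t.
have si : lebesgue_measure.-integrable `[c, d] (EFin \o s).
  exact (integrableD mcd fi egDi).
have zi : lebesgue_measure.-integrable `[c, d] (EFin \o (fun t => w t * derive1 z t)).
  apply: integrable_itv_oo_cc.
  have sioo : lebesgue_measure.-integrable `]c, d[ (EFin \o s).
    apply: (integrableS _ _ _ si); [exact: mcd|exact: measurable_itv|].
    exact: subset_itv_oo_cc.
  apply: eq_integrable sioo; first exact: measurable_itv.
  by move=> t; rewrite inE/= => tcd; rewrite zE.
split => //.
rewrite -(Rintegral_itv_oo_cc zi).
transitivity (\int[lebesgue_measure]_(t in `]c, d[) s t).
  by apply: eq_Rintegral => t; rewrite inE/=; exact: zE.
rewrite (Rintegral_itv_oo_cc si) /s (RintegralD mcd fi egDi) (RintegralZl _ mcd gDi).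
congr (_ + _ * _).
rewrite -(Rintegral_itv_oo_cc gDi) -(Rintegral_itv_oo_cc gi).
have ocd : [set` `]c, d[ ] `<=` [set` `[c, d]] by exact: subset_itv_oo_cc.
have mcd' : measurable ([set` `]c, d[ ] : set (measurableTypeR R)).
  exact: measurable_itv.
congr fine; apply: ae_eq_integral => //.
- exact: measurable_int (integrableS mcd mcd' ocd gDi).
- exact: measurable_int (integrableS mcd mcd' ocd gi).
- case: aef => Z [mZ Z0 subZ]; exists Z; split => //.
  apply: subset_trans subZ => t /= nE dt; apply: nE => tcd.
  rewrite /gD indicE mem_set ?mulr1//.
  by split; [exact: oo|exact/dt/oo].
Qed.

Lemma abs_continuous_perturb (R : realType) (a b e M : R) (f k : R -> R) :
  abs_continuous a b f ->
  (forall u v, a <= u -> u <= v -> v <= b -> `|k v - k u| <= M * (v - u)) ->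
  abs_continuous a b (fun x => f x + e * k x).
Proof.
move=> acf kM eps eps0.
have eps2 : 0 < eps / 2 by rewrite divr_gt0.
have [d d0 hd] := acf _ eps2.
(* A positive Lipschitz bound for [e * k], whatever the signs of [e] and [M]; half of [eps] goes to
   [f] and half to [e * k]. *)
have K0 : 0 < `|e| * `|M| + 1 by rewrite ltr_wpDl// mulr_ge0.
exists (Num.min d (eps / 2 / (`|e| * `|M| + 1))).
  by rewrite lt_min d0 divr_gt0.
move=> n u v huv tI; rewrite lt_min => /andP[sd se].
apply: (@le_lt_trans _ _ (\sum_(i < n) `|f (v i) - f (u i)| +
    (`|e| * `|M| + 1) * \sum_(i < n) (v i - u i))).
  rewrite mulr_sumr -big_split/=; apply: ler_sum => i _.
  have [au uv vb] := huv i.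
  have -> : f (v i) + e * k (v i) - (f (u i) + e * k (u i)) =
    (f (v i) - f (u i)) + e * (k (v i) - k (u i)) by ring.
  apply: (le_trans (ler_normD _ _)); rewrite lerD2l normrM.
  apply: (@le_trans _ _ (`|e| * `|M| * (v i - u i))).
    rewrite -mulrA ler_wpM2l// (le_trans (kM _ _ au uv vb))//.
    by rewrite ler_wpM2r ?subr_ge0// ler_norm.
  by rewrite ler_wpM2r ?subr_ge0// lerDl.
rewrite [ltRHS]splitr ltrD ?hd//.
by move: se; rewrite ltr_pdivlMr// mulrC.
Qed.

Lemma primitive_lipschitz (R : realType) (g : R -> R) (a b : R) :
  continuous g -> exists M : R, forall u v, a <= u -> u <= v -> v <= b ->
    `|\int[lebesgue_measure]_(s in `[a, v]) g s -
      \int[lebesgue_measure]_(s in `[a, u]) g s| <= M * (v - u).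
Proof.
move=> cg; have [M M0 gM] := @continuous_bounded_itv R g a b cg.
exists M => u v au uv vb.
have ig := continuous_integrable_itv a v cg.
rewrite Rintegral_itvB ?bnd_simp//.
have muv : measurable ([set` `]u, v]] : set (measurableTypeR R)).
  exact: measurable_itv.
have iuv : lebesgue_measure.-integrable `]u, v] (EFin \o g).
  apply: (integrableS _ _ _ ig); [exact: measurable_itv|exact: muv|].
  by apply: subset_itvr; rewrite bnd_simp.
apply: (le_trans (le_normr_Rintegral muv iuv)).
have -> : M * (v - u) = \int[lebesgue_measure]_(s in `]u, v]) (cst M s).
  rewrite Rintegral_cst//= lebesgue_measure_itv/= lte_fin.
  by case: ltgtP uv => // ->; rewrite subrr !mulr0.
apply: le_Rintegral => //.
- exact: integrable_norm iuv.
- apply: (integrableS _ _ _ (continuous_integrable_itv a v (@cst_continuous _ _ M))).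
  + exact: measurable_itv.
  + exact: muv.
  + by apply: subset_itvr; rewrite bnd_simp.
- move=> t /=; rewrite in_itv/= => /andP[ut tv]; apply: gM.
  by rewrite in_itv/= (le_trans au (ltW ut)) (le_trans tv vb).
Qed.

(** At [t = x] both kernels vanish, since a power of 0 with nonzero exponent is 0; this is where
    [0 < g] enters. *)
Lemma left_kernelE (R : realType) (g : R) (f : R -> R) (x t : R) : 0 < g ->
  t <= x -> left_kernel g f x t = frac_ker g ((-1) ^+ false * (x - t)) * f t.
Proof.
move=> g0 tx; rewrite /left_kernel /frac_ker expr0 mul1r subr_gt0; congr (_ * _).
case: ltgtP tx => // -> _.
by rewrite subrr powR0// oppr_eq0 gt_eqF.
Qed.

Lemma right_kernelE (R : realType) (g : R) (f : R -> R) (x t : R) : 0 < g ->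
  x <= t -> right_kernel g f x t = frac_ker g ((-1) ^+ true * (x - t)) * f t.
Proof.
move=> g0 xt; rewrite /right_kernel /frac_ker expr1 mulN1r opprB subr_gt0; congr (_ * _).
case: ltgtP xt => // -> _.
by rewrite subrr powR0// oppr_eq0 gt_eqF.
Qed.

Lemma Rintegral_left_kernel (R : realType) (g a x : R) (f : R -> R) : 0 < g ->
  \int[lebesgue_measure]_(t in `[a, x]) left_kernel g f x t =
  frac_conv false g f a x x.
Proof.
move=> g0; apply: eq_Rintegral => t; rewrite inE/= in_itv/= => /andP[_ tx].
exact: left_kernelE.
Qed.

Lemma Rintegral_right_kernel (R : realType) (g b x : R) (f : R -> R) : 0 < g ->
  \int[lebesgue_measure]_(t in `[x, b]) right_kernel g f x t =
  frac_conv true g f x b x.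
Proof.
move=> g0; apply: eq_Rintegral => t; rewrite inE/= in_itv/= => /andP[xt _].
exact: right_kernelE.
Qed.

(** The truncated kernel ignores [t > x], so the moving endpoint can be traded for a fixed one, as
    Fubini and continuity in [x] require. *)
Lemma frac_conv_left (R : realType) (g a b x : R) (f : R -> R) : x <= b ->
  frac_conv false g f a x x = frac_conv false g f a b x.
Proof.
move=> xb; rewrite /frac_conv Rintegral_mkcond [RHS]Rintegral_mkcond.
apply: eq_Rintegral => t _; rewrite !patchE !mem_setE !in_itv/=.
case: (leP a t) => //= at_; case: (leP t x) => [tx|xt].
  by rewrite (le_trans tx xb).
case: ifP => // _; rewrite frac_ker_le0 ?mul0r// expr0 mul1r subr_le0 ltW//.
Qed.

Lemma frac_conv_right (R : realType) (g a b x : R) (f : R -> R) : a <= x ->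
  frac_conv true g f x b x = frac_conv true g f a b x.
Proof.
move=> ax; rewrite /frac_conv Rintegral_mkcond [RHS]Rintegral_mkcond.
apply: eq_Rintegral => t _; rewrite !patchE !mem_setE !in_itv/=.
case: (leP x t) => /= [xt|tx].
  by rewrite (le_trans ax xt).
case: ifP => // _; rewrite frac_ker_le0 ?mul0r// expr1 mulN1r opprB subr_le0 ltW//.
Qed.

Lemma ae_derivable_perturb (R : realType) (a b e : R) (f k g : R -> R) :
  {ae lebesgue_measure, forall t : R, t \in `]a, b[ -> derivable f t 1} ->
  (forall t, t \in `]a, b[ -> is_derive t (1 : R) k (g t)) ->
  {ae lebesgue_measure, forall t : R,
    t \in `]a, b[ -> derivable (fun x => f x + e * k x) t 1}.
Proof.
move=> [Z [mZ Z0 subZ]] dk; exists Z; split; [exact: mZ|exact: Z0|].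
apply: subset_trans subZ => t /= nd df; apply: nd => tab.
by have [kt _] := dk t tab; apply: derivableD; [exact: df|exact: derivableZ].
Qed.

(** On []a, b]] this is [Rintegral_derive1_perturb] with the Abel kernel as weight. At [a] the
    Caputo derivative is by definition a limit, so the formula there follows from its validity to
    the right of [a] and the continuity of [frac_conv]. *)
Lemma caputo_left_perturb (R : realType) (a b al e : R) (y g : R -> R) :
  a < b -> 0 < al < 1 -> continuous g -> caputo_left_exists a b al y ->
  let z x := y x + e * \int[lebesgue_measure]_(s in `[a, x]) g s in
  caputo_left_exists a b al z /\
  forall x, x \in `[a, b] -> caputo_left a al z x =
    caputo_left a al y x + e * ((Gamma (1 - al))^-1 * frac_conv false al g a b x).
Proof.
move=> ab /andP[al0 al1] cg [acy aey iy cy] z.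
have cyc := abs_continuous_within acy.
have dk t : t \in `]a, b[ ->
    is_derive t (1 : R) (fun x => \int[lebesgue_measure]_(s in `[a, x]) g s) (g t).
  by rewrite in_itv/= => /andP[at_ _]; exact: is_derive_primitive.
have cfg : continuous (frac_conv false al g a b).
  by apply: continuous_frac_conv => //; rewrite ?al1 ?(ltW al0)// ltW.
have iE f x : lebesgue_measure.-integrable `[a, x] (EFin \o left_kernel al f x) <->
    lebesgue_measure.-integrable `[a, x]
      (EFin \o (fun t => frac_ker al ((-1) ^+ false * (x - t)) * f t)).
  by split; apply: eq_integrable; try exact: measurable_itv; move=> t;
    rewrite inE/= in_itv/= => /andP[_ tx]; rewrite left_kernelE.
have key x : x \in `]a, b] ->
    lebesgue_measure.-integrable `[a, x] (EFin \o left_kernel al (derive1 z) x) /\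
    caputo_left_int a al z x = caputo_left_int a al y x +
      e * ((Gamma (1 - al))^-1 * frac_conv false al g a b x).
  move=> xab; have := xab; rewrite in_itv/= => /andP[ax xb].
  have [zi zE] := @Rintegral_derive1_perturb R a b a x e
    (fun t => frac_ker al ((-1) ^+ false * (x - t))) y _ g ab (lexx a) xb cyc aey dk
    ((iE _ _).1 (iy x xab)) (integrable_frac_conv false a x x al1 cg).
  split; first exact/iE.
  rewrite /caputo_left_int !Rintegral_left_kernel// -(frac_conv_left al a g xb).
  rewrite /frac_conv zE; ring.
have cz : caputo_left_int a al z s @[s --> a^'+] -->
    lim (caputo_left_int a al y s @[s --> a^'+]) +
    e * ((Gamma (1 - al))^-1 * frac_conv false al g a b a).
  have : (fun s => caputo_left_int a al y s +
      e * ((Gamma (1 - al))^-1 * frac_conv false al g a b s)) s @[s --> a^'+] -->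
    lim (caputo_left_int a al y s @[s --> a^'+]) +
    e * ((Gamma (1 - al))^-1 * frac_conv false al g a b a).
    apply: cvgD => //; apply: cvgMl_tmp; apply: cvgMl_tmp.
    exact/cvg_at_right_filter/cfg.
  apply: cvg_trans; apply: near_eq_cvg; near=> s.
  have /key[_ ->//] : s \in `]a, b].
    rewrite in_itv/=; apply/andP; split; near: s; first exact: nbhs_right_gt.
    exact: nbhs_right_le.
split.
  split.
  - have [M kM] := primitive_lipschitz a b cg.
    exact: abs_continuous_perturb acy kM.
  - exact: ae_derivable_perturb aey dk.
  - by move=> x /key[].
  - by apply/cvg_ex; eexists; exact: cz.
move=> x xab; rewrite /caputo_left; case: eqVneq => [->|xa].
  exact: cvg_lim cz.
by have /key[_ ->] : x \in `]a, b]
  by move: xab; rewrite !in_itv/= lt_neqAle eq_sym xa.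
Unshelve. all: by end_near. Qed.

(** The variation is still the primitive based at [a]: another base point would only add a constant,
    which Caputo derivatives do not see. The minus sign is that of the right Caputo derivative. *)
Lemma caputo_right_perturb (R : realType) (a b al e : R) (y g : R -> R) :
  a < b -> 0 < al < 1 -> continuous g -> caputo_right_exists a b al y ->
  let z x := y x + e * \int[lebesgue_measure]_(s in `[a, x]) g s in
  caputo_right_exists a b al z /\
  forall x, x \in `[a, b] -> caputo_right b al z x =
    caputo_right b al y x + e * (- (Gamma (1 - al))^-1 * frac_conv true al g a b x).
Proof.
move=> ab /andP[al0 al1] cg [acy aey iy cy] z.
have cyc := abs_continuous_within acy.
have dk t : t \in `]a, b[ ->
    is_derive t (1 : R) (fun x => \int[lebesgue_measure]_(s in `[a, x]) g s) (g t).
  by rewrite in_itv/= => /andP[at_ _]; exact: is_derive_primitive.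
have cfg : continuous (frac_conv true al g a b).
  by apply: continuous_frac_conv => //; rewrite ?al1 ?(ltW al0)// ltW.
have iE f x : lebesgue_measure.-integrable `[x, b] (EFin \o right_kernel al f x) <->
    lebesgue_measure.-integrable `[x, b]
      (EFin \o (fun t => frac_ker al ((-1) ^+ true * (x - t)) * f t)).
  by split; apply: eq_integrable; try exact: measurable_itv; move=> t;
    rewrite inE/= in_itv/= => /andP[xt _]; rewrite right_kernelE.
have key x : x \in `[a, b[ ->
    lebesgue_measure.-integrable `[x, b] (EFin \o right_kernel al (derive1 z) x) /\
    caputo_right_int b al z x = caputo_right_int b al y x +
      e * (- (Gamma (1 - al))^-1 * frac_conv true al g a b x).
  move=> xab; have := xab; rewrite in_itv/= => /andP[ax xb].
  have [zi zE] := @Rintegral_derive1_perturb R a b x b e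
    (fun t => frac_ker al ((-1) ^+ true * (x - t))) y _ g ab ax (lexx b) cyc aey dk
    ((iE _ _).1 (iy x xab)) (integrable_frac_conv true x b x al1 cg).
  split; first exact/iE.
  rewrite /caputo_right_int !Rintegral_right_kernel// -(frac_conv_right al b g ax).
  rewrite /frac_conv zE; ring.
have cz : caputo_right_int b al z s @[s --> b^'-] -->
    lim (caputo_right_int b al y s @[s --> b^'-]) +
    e * (- (Gamma (1 - al))^-1 * frac_conv true al g a b b).
  have : (fun s => caputo_right_int b al y s +
      e * (- (Gamma (1 - al))^-1 * frac_conv true al g a b s)) s @[s --> b^'-] -->
    lim (caputo_right_int b al y s @[s --> b^'-]) +
    e * (- (Gamma (1 - al))^-1 * frac_conv true al g a b b).
    apply: cvgD => //; apply: cvgMl_tmp; apply: cvgMl_tmp.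
    exact/cvg_at_left_filter/cfg.
  apply: cvg_trans; apply: near_eq_cvg; near=> s.
  have /key[_ ->//] : s \in `[a, b[.
    rewrite in_itv/=; apply/andP; split; near: s; last exact: nbhs_left_lt.
    exact: nbhs_left_ge.
split.
  split.
  - have [M kM] := primitive_lipschitz a b cg.
    exact: abs_continuous_perturb acy kM.
  - exact: ae_derivable_perturb aey dk.
  - by move=> x /key[].
  - by apply/cvg_ex; eexists; exact: cz.
move=> x xab; rewrite /caputo_right; case: eqVneq => [->|xb].
  exact: cvg_lim cz.
by have /key[_ ->] : x \in `[a, b[
  by move: xab; rewrite !in_itv/= (lt_neqAle x) xb.
Unshelve. all: by end_near. Qed.

Lemma within_continuous_perturb (R : realType) (a b e : R) (f f' h : R -> R) :
  {within `[a, b], continuous f} -> continuous h ->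
  (forall x, x \in `[a, b] -> f' x = f x + e * h x) ->
  {within `[a, b], continuous f'}.
Proof.
move=> /subspace_continuousP cf ch fE; apply/subspace_continuousP => x xab.
rewrite /from_subspace fE//.
have : (fun x => f x + e * h x) t @[t --> within `[a, b] (nbhs x)] --> f x + e * h x.
  apply: cvgD; first exact: cf.
  by apply: cvgMl_tmp; apply: cvg_within_filter; exact: ch.
apply: cvg_trans; apply: near_eq_cvg; rewrite near_withinE.
by apply: nearW => t tab; rewrite fE.
Qed.

Lemma caputo_space_perturb (R : realType) (a b al be e : R) (y g : R -> R) :
  a < b -> 0 < al < 1 -> 0 < be < 1 -> continuous g ->
  caputo_space a b al be y ->
  let z x := y x + e * \int[lebesgue_measure]_(s in `[a, x]) g s in
  [/\ caputo_space a b al be z,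
      forall x, x \in `[a, b] -> caputo_left a al z x = caputo_left a al y x +
        e * ((Gamma (1 - al))^-1 * frac_conv false al g a b x) &
      forall x, x \in `[a, b] -> caputo_right b be z x = caputo_right b be y x +
        e * (- (Gamma (1 - be))^-1 * frac_conv true be g a b x)].
Proof.
move=> ab hal hbe cg [hl cl hr cr] z.
have [hlz lE] := caputo_left_perturb e ab hal cg hl.
have [hrz rE] := caputo_right_perturb e ab hbe cg hr.
have cfc b' ga : 0 < ga < 1 -> continuous (frac_conv b' ga g a b).
  move=> /andP[ga0 ga1]; have ga01 : 0 <= ga < 1 by rewrite ga1 ltW.
  exact: (continuous_frac_conv ga01 (ltW ab) cg).
split; [split; [exact: hlz| |exact: hrz|]|exact: lE|exact: rE].
- apply: (within_continuous_perturb cl _ lE) => x; apply: cvgMl_tmp.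
  exact: (cfc _ _ hal).
- apply: (within_continuous_perturb cr _ rE) => x; apply: cvgMl_tmp.
  exact: (cfc _ _ hbe).
Qed.

(** * The first variation *)

Lemma within_continuous_comp (R : realType) (T : topologicalType) (S : set T)
    (f : T -> R) (h : R -> T) : {within S, continuous f} -> continuous h ->
  (forall x, S (h x)) -> continuous (f \o h).
Proof.
move=> /subspace_continuousP cf ch hS x; have := cf _ (hS x); apply: cvg_comp.
move=> U /= hU.
have : \forall y \near x, S (h y) -> U (h y) by exact: (ch x [set u | S u -> U u] hU).
by apply: filterS => y; apply; exact: hS.
Qed.

Lemma continuous_strip_curve (R : realType) (a b : R) (F : R -> R -> R -> R -> R)
    (Y U V : R -> R) : a <= b -> continuous_on_strip a b F ->
  continuous Y -> continuous U -> continuous V ->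
  continuous (fun x => F (clamp a b x) (Y x) (U x) (V x)).
Proof.
move=> ab cF cY cU cV.
have := @within_continuous_comp R _ _ _ (fun x => (clamp a b x, Y x, U x, V x)) cF.
apply; last by move=> x /=; exact: clamp_itv.
have pairC (T1 T2 : topologicalType) (f : R -> T1) (g : R -> T2) :
    continuous f -> continuous g -> continuous (fun x => (f x, g x)).
  by move=> cf cg x; apply: cvg_pair => //; [exact: cf|exact: cg].
apply: (pairC _ _ _ _ _ cV); apply: (pairC _ _ _ _ _ cU).
exact: (pairC _ _ _ _ (@continuous_clamp R a b) cY).
Qed.

Lemma continuous_strip_ball (R : realType) (a b : R) (F : R -> R -> R -> R -> R)
    (x0 y0 u0 v0 e : R) : continuous_on_strip a b F -> x0 \in `[a, b] -> 0 < e ->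
  exists2 r, 0 < r & forall x y u v, x \in `[a, b] ->
    `|x0 - x| < r -> `|y0 - y| < r -> `|u0 - u| < r -> `|v0 - v| < r ->
    `|F x y u v - F x0 y0 u0 v0| <= e.
Proof.
move=> /subspace_continuousP cF x0ab e0.
have /cvgrPdist_le/(_ _ e0) := cF (x0, y0, u0, v0) x0ab.
rewrite near_withinE => /nbhs_ballP[r /= r0 hr]; exists r => //.
move=> x y u v xab hx hy hu hv; rewrite distrC.
apply: (hr (x, y, u, v)) => //.
Qed.

(* Stated around a fixed slope [m], and not the derivative at [p], so that it can
   be chained over the coordinates. *)
Lemma increment_bound (R : realType) (f : R -> R) (s0 r m e p q : R) :
  (forall s, derivable f s 1) ->
  (forall s, `|s0 - s| < r -> `|derive1 f s - m| <= e) ->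
  `|s0 - p| < r -> `|s0 - q| < r -> `|f q - f p - m * (q - p)| <= e * `|q - p|.
Proof.
move=> df fm.
have main p' q' : p' < q' -> `|s0 - p'| < r -> `|s0 - q'| < r ->
    `|f q' - f p' - m * (q' - p')| <= e * `|q' - p'|.
  move=> pq hp hq.
  have [c cpq ->] : exists2 c, c \in `]p', q'[ & f q' - f p' = derive1 f c * (q' - p').
    apply: MVT => //; first by move=> t _; split => //; rewrite derive1E.
    by apply: derivable_within_continuous => t _.
  rewrite -mulrBl normrM ler_wpM2r//; apply: fm.
  move: cpq hp hq; rewrite in_itv/= !ltr_norml => /andP[? ?] /andP[? ?] /andP[? ?].
  by apply/andP; split; lra.
move=> hp hq; have [pq|pq|->] := ltgtP p q; first exact: main.
  have := main _ _ pq hq hp; rewrite (distrC p).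
  by rewrite -(normrN (_ - _ * _)); congr (`|_| <= _); ring.
by rewrite !subrr mulr0 subrr normr0 mulr0.
Qed.

(** The passage to [(y', u', v')] changes one coordinate at a time and stays in a cube on which each
    partial is within [e] of its value at the center; the mean value theorem applies on each edge.
    Freezing the slopes at the center while [x] varies makes the bound uniform in nearby [x]. *)
Lemma C1_increment (R : realType) (a b : R) (L : R -> R -> R -> R -> R)
    (x0 y0 u0 v0 e : R) : C1_on_strip a b L -> x0 \in `[a, b] -> 0 < e ->
  exists2 r, 0 < r & forall x y u v y' u' v', x \in `[a, b] ->
    `|x0 - x| < r -> `|y0 - y| < r -> `|u0 - u| < r -> `|v0 - v| < r ->
    `|y0 - y'| < r -> `|u0 - u'| < r -> `|v0 - v'| < r ->
    `|L x y' u' v' - L x y u v -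
      (partial2 L x0 y0 u0 v0 * (y' - y) + partial3 L x0 y0 u0 v0 * (u' - u) +
       partial4 L x0 y0 u0 v0 * (v' - v))|
    <= e * (`|y' - y| + `|u' - u| + `|v' - v|).
Proof.
move=> [dL [_ c2 c3 c4]] x0ab e0.
have [r2 r20 h2] := continuous_strip_ball y0 u0 v0 c2 x0ab e0.
have [r3 r30 h3] := continuous_strip_ball y0 u0 v0 c3 x0ab e0.
have [r4 r40 h4] := continuous_strip_ball y0 u0 v0 c4 x0ab e0.
pose r := Num.min r2 (Num.min r3 r4).
exists r; first by rewrite !lt_min r20 r30 r40.
have rr : [/\ r <= r2, r <= r3 & r <= r4].
  by rewrite /r !ge_min !lexx !orbT.
case: rr => rr2 rr3 rr4.
move=> x y u v y' u' v' xab hx hy hu hv hy' hu' hv'.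
have lt2 z : `|z| < r -> `|z| < r2 by move/lt_le_trans; apply.
have lt3 z : `|z| < r -> `|z| < r3 by move/lt_le_trans; apply.
have lt4 z : `|z| < r -> `|z| < r4 by move/lt_le_trans; apply.
have b2 : `|L x y' u' v' - L x y u' v' - partial2 L x0 y0 u0 v0 * (y' - y)|
    <= e * `|y' - y|.
  apply: (@increment_bound R (fun s => L x s u' v') y0 r2); [| |exact: lt2|exact: lt2].
    by move=> s; have [_ dk _ _] := dL x s u' v' xab; exact: dk.
  by move=> s hs; apply: h2 => //; exact: lt2.
have b3 : `|L x y u' v' - L x y u v' - partial3 L x0 y0 u0 v0 * (u' - u)|
    <= e * `|u' - u|.
  apply: (@increment_bound R (fun s => L x y s v') u0 r3); [| |exact: lt3|exact: lt3].
    by move=> s; have [_ _ dk _] := dL x y s v' xab; exact: dk.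
  by move=> s hs; apply: h3 => //; exact: lt3.
have b4 : `|L x y u v' - L x y u v - partial4 L x0 y0 u0 v0 * (v' - v)|
    <= e * `|v' - v|.
  apply: (@increment_bound R (fun s => L x y u s) v0 r4); [| |exact: lt4|exact: lt4].
    by move=> s; have [_ _ _ dk] := dL x y u s xab; exact: dk.
  by move=> s hs; apply: h4 => //; exact: lt4.
have -> : L x y' u' v' - L x y u v -
      (partial2 L x0 y0 u0 v0 * (y' - y) + partial3 L x0 y0 u0 v0 * (u' - u) +
       partial4 L x0 y0 u0 v0 * (v' - v)) =
  (L x y' u' v' - L x y u' v' - partial2 L x0 y0 u0 v0 * (y' - y)) +
  (L x y u' v' - L x y u v' - partial3 L x0 y0 u0 v0 * (u' - u)) +
  (L x y u v' - L x y u v - partial4 L x0 y0 u0 v0 * (v' - v)) by ring.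
rewrite [leRHS]mulrDr [X in _ <= X + _]mulrDr.
apply: (le_trans (ler_normD _ _)); apply: lerD => //.
by apply: (le_trans (ler_normD _ _)); exact: lerD.
Qed.

Lemma derivable_in_continuous (R : realType) (p q : R) (f : R -> R) :
  (forall x, x \in `[p, q] -> derivable_in p q f x) ->
  {within `[p, q], continuous f}.
Proof.
move=> df; apply/subspace_continuousP => x xpq.
(* Tolerance 1 bounds the difference quotients near [x] by the absolute value of [l] plus 1, a local
   Lipschitz estimate at [x]. *)
have /cvg_ex[l /cvgrPdist_lt/(_ _ ltr01)] := df x xpq.
rewrite near_withinE => /nbhs_ballP[d /= d0 hd].
apply/cvgrPdist_lt => e e0; rewrite near_withinE.
have K0 : 0 < `|l| + 1 by rewrite ltr_wpDl.
apply/nbhs_ballP; exists (Num.min d (e / (`|l| + 1))) => /=.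
  by rewrite lt_min d0 divr_gt0.
move=> t; rewrite /ball/= lt_min => /andP[xtd xte] tpq.
have [->|tx] := eqVneq t x; first by rewrite subrr normr0.
have tx0 : t - x != 0 by rewrite subr_eq0.
have := hd t xtd tx tpq; set Q := _ / _ => hQ.
rewrite distrC (_ : _ - _ = Q * (t - x)); last by rewrite /Q divfK.
rewrite normrM; apply: (@le_lt_trans _ _ ((`|l| + 1) * `|t - x|)).
  rewrite ler_wpM2r// -[Q](subrK l) addrC (le_trans (ler_normD _ _))// lerD2l.
  by rewrite distrC ltW.
by rewrite mulrC -ltr_pdivlMr// distrC.
Qed.

(** [C1_on_strip] asserts derivability of [L] in each variable separately, so joint continuity has
    to be derived. The curve is compared with [g1], in which only the first argument moves: [g1] is
    continuous by derivability in that variable, and the difference is controlled by [C1_increment],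
    where tolerance 1 suffices because the increments themselves tend to 0. *)
Lemma continuous_C1_curve (R : realType) (a b : R) (L : R -> R -> R -> R -> R)
    (Y U V : R -> R) : a <= b -> C1_on_strip a b L ->
  continuous Y -> continuous U -> continuous V ->
  continuous (fun x => L (clamp a b x) (Y x) (U x) (V x)).
Proof.
move=> ab C1 cY cU cV x.
have [r r0 hr] := C1_increment (Y x) (U x) (V x) C1 (clamp_itv x ab) ltr01.
pose m2 := partial2 L (clamp a b x) (Y x) (U x) (V x).
pose m3 := partial3 L (clamp a b x) (Y x) (U x) (V x).
pose m4 := partial4 L (clamp a b x) (Y x) (U x) (V x).
pose rho x' := `|m2 * (Y x' - Y x) + m3 * (U x' - U x) + m4 * (V x' - V x)| +
  (`|Y x' - Y x| + `|U x' - U x| + `|V x' - V x|).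
have cB (f : R -> R) : continuous f -> f x' - f x @[x' --> x] --> (0 : R).
  move=> cf; rewrite -[X in _ --> X](subrr (f x)).
  by apply: cvgB; [exact: cf|exact: cvg_cst].
have cN (f : R -> R) : continuous f -> `|f x' - f x| @[x' --> x] --> (0 : R).
  by move=> cf; rewrite -[X in _ --> X](@normr0 _ R); apply: cvg_norm; exact: cB.
have crho : rho x' @[x' --> x] --> (0 : R).
  have -> : (0 : R) = `|m2 * 0 + m3 * 0 + m4 * 0| + (0 + 0 + 0).
    by rewrite !mulr0 !addr0 normr0.
  apply: cvgD; last by apply: cvgD; [apply: cvgD|]; exact: cN.
  apply: cvg_norm; apply: cvgD; [apply: cvgD|];
    by apply: cvgMl_tmp; exact: cB.
pose g1 x' := L (clamp a b x') (Y x) (U x) (V x).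
have cg1 : {for x, continuous g1}.
  apply: (@within_continuous_clamp R a b (fun s => L s (Y x) (U x) (V x))) => //.
  apply: derivable_in_continuous => s sab.
  by have [d1 _ _ _] := C1.1 s (Y x) (U x) (V x) sab; exact: d1.
pose g x' := L (clamp a b x') (Y x') (U x') (V x').
have cdiff : g x' - g1 x' @[x' --> x] --> (0 : R).
  apply/cvgr0Pnorm_le => e e0; near=> x'.
  apply: (@le_trans _ _ (rho x')).
    have := hr (clamp a b x') (Y x) (U x) (V x) (Y x') (U x') (V x').
    rewrite !subrr normr0 mul1r -/m2 -/m3 -/m4 -/(g x') -/(g1 x') => hrx.
    rewrite -[X in `|X|](subrK (m2 * (Y x' - Y x) + m3 * (U x' - U x) + m4 * (V x' - V x))).
    rewrite addrC (le_trans (ler_normD _ _))// lerD2l; apply: hrx => //.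
    - exact: clamp_itv.
    - near: x'; apply: cvgr_dist_lt => //.
      exact: continuous_clamp.
    - by near: x'; apply: cvgr_dist_lt => //; exact: cY.
    - by near: x'; apply: cvgr_dist_lt => //; exact: cU.
    - by near: x'; apply: cvgr_dist_lt => //; exact: cV.
  near: x'; exact: (cvgr_le _ crho).
have -> : (fun x => L (clamp a b x) (Y x) (U x) (V x)) = fun x' => (g x' - g1 x') + g1 x'.
  by apply/funext => x'; rewrite subrK.
by apply: cvgD; [rewrite /g1 subrr; exact: cdiff|exact: cg1].
Unshelve. all: by end_near. Qed.

(** The expansion holds for [x] near a given [x0] and [e] near 0 by [C1_increment]; compactness of
    [[A, B]], in its near-covering form, provides one neighborhood of [e = 0] valid for all [x]. *)
Lemma C1_increment_uniform (R : realType) (a b A B : R)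
    (L : R -> R -> R -> R -> R) (Y U V y1 u1 v1 : R -> R) (eps : R) :
  a <= A -> A <= B -> B <= b -> C1_on_strip a b L ->
  continuous Y -> continuous U -> continuous V ->
  continuous y1 -> continuous u1 -> continuous v1 -> 0 < eps ->
  \forall e \near (0 : R), forall x, x \in `[A, B] ->
    `|L x (Y x + e * y1 x) (U x + e * u1 x) (V x + e * v1 x) -
      L x (Y x) (U x) (V x) -
      e * (partial2 L x (Y x) (U x) (V x) * y1 x +
           partial3 L x (Y x) (U x) (V x) * u1 x +
           partial4 L x (Y x) (U x) (V x) * v1 x)| <= eps * `|e|.
Proof.
move=> aA AB Bb C1 cY cU cV cy1 cu1 cv1 eps0.
have ab : a <= b by rewrite (le_trans aA)// (le_trans AB).
have abE x : x \in `[A, B] -> x \in `[a, b].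
  by rewrite !in_itv/= => /andP[Ax xB]; rewrite (le_trans aA Ax) (le_trans xB Bb).
pose D x := partial2 L (clamp a b x) (Y x) (U x) (V x) * y1 x +
  partial3 L (clamp a b x) (Y x) (U x) (V x) * u1 x +
  partial4 L (clamp a b x) (Y x) (U x) (V x) * v1 x.
have cD : continuous D.
  have [_ [_ c2 c3 c4]] := C1.
  move=> x; apply: cvgD; [apply: cvgD|]; apply: cvgM.
  - exact: (continuous_strip_curve ab c2 cY cU cV).
  - exact: cy1.
  - exact: (continuous_strip_curve ab c3 cY cU cV).
  - exact: cu1.
  - exact: (continuous_strip_curve ab c4 cY cU cV).
  - exact: cv1.
have nc := (compact_near_coveringP _).1 (@segment_compact R A B).
pose P (e x : R) := x \in `[A, B] ->
  `|L x (Y x + e * y1 x) (U x + e * u1 x) (V x + e * v1 x) -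
      L x (Y x) (U x) (V x) - e * D x| <= eps * `|e|.
have hP : forall x, `[A, B]%classic x -> \forall x' \near x & e \near (0 : R), P e x'.
  move=> x0 /= x0AB; have x0ab := abE _ x0AB.
  pose y0 := Y x0; pose u0 := U x0; pose v0 := V x0.
  pose S x := `|y1 x| + `|u1 x| + `|v1 x|.
  have cS : continuous S.
    by move=> x; apply: cvgD; [apply: cvgD|]; apply: cvg_norm;
      [exact: cy1|exact: cu1|exact: cv1].
  have S0 x : 0 <= S x by rewrite !addr_ge0.
  (* [K] bounds [S] near [x0]; tolerance [eps / 2 / K] in [C1_increment] thus costs at most half of
     the allowed error. *)
  pose K := S x0 + 1.
  have K0 : 0 < K by rewrite ltr_wpDl.
  have e10 : 0 < eps / 2 / K by rewrite !divr_gt0.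
  have [r r0 hr] := C1_increment y0 u0 v0 C1 x0ab e10.
  set m2 := partial2 _ _ _ _ _ in hr; set m3 := partial3 _ _ _ _ _ in hr.
  set m4 := partial4 _ _ _ _ _ in hr.
  (* The error of replacing the partials at [x] by those at [x0]; it vanishes at [x0], hence takes
     the other half of [eps] near [x0]. *)
  pose E x := D x - (m2 * y1 x + m3 * u1 x + m4 * v1 x).
  have cE : E x @[x --> x0] --> (0 : R).
    have -> : 0 = E x0 by rewrite /E /D clamp_id// subrr.
    apply: cvgB; first exact: cD.
    by apply: cvgD; [apply: cvgD|]; apply: cvgMl_tmp; [exact: cy1|exact: cu1|exact: cv1].
  have r2 : 0 < r / 2 by rewrite divr_gt0.
  near=> x e => /= xAB.
  have SK : S x <= K.
    near: x; apply: cvgr_le; first exact: cS.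
    by rewrite /K ltrDl.
  have eK : `|e| * K < r / 2.
    rewrite -ltr_pdivlMr//; near: e.
    by apply: (@cvgr0_norm_lt R R R); [exact: cvg_id|rewrite divr_gt0].
  have small (z : R) : `|z| <= S x -> `|e * z| < r / 2.
    move=> zS; apply: le_lt_trans eK; rewrite normrM ler_wpM2l//.
    exact: le_trans zS SK.
  have Ex : `|E x| <= eps / 2.
    near: x; apply: cvgr0_norm_le => //; by rewrite divr_gt0.
  have hY : `|y0 - Y x| < r / 2 by near: x; apply: cvgr_dist_lt => //; exact: cY.
  have hU : `|u0 - U x| < r / 2 by near: x; apply: cvgr_dist_lt => //; exact: cU.
  have hV : `|v0 - V x| < r / 2 by near: x; apply: cvgr_dist_lt => //; exact: cV.
  have hx : `|x0 - x| < r by near: x; apply: cvgr_dist_lt => //; exact: cvg_id.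
  have sy : `|e * y1 x| < r / 2 by apply: small; rewrite /S -addrA lerDl addr_ge0.
  have su : `|e * u1 x| < r / 2.
    by apply: small; rewrite /S addrAC lerDr addr_ge0.
  have sv : `|e * v1 x| < r / 2 by apply: small; rewrite /S lerDr addr_ge0.
  have far (z w s : R) : `|z - w| < r / 2 -> `|s| < r / 2 -> `|z - (w + s)| < r.
    move=> zw sr; rewrite opprD addrA [ltRHS]splitr.
    by apply: (le_lt_trans (ler_normB _ _)); exact: ltrD.
  have near_ (z : R) : `|z| < r / 2 -> `|z| < r.
    by move=> /lt_trans; apply; rewrite ltr_pdivrMr// ltr_pMr// ltr1n.
  have := hr x (Y x) (U x) (V x) (Y x + e * y1 x) (U x + e * u1 x) (V x + e * v1 x)
    (abE _ xAB) hx (near_ _ hY) (near_ _ hU) (near_ _ hV)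
    (far _ _ _ hY sy) (far _ _ _ hU su) (far _ _ _ hV sv).
  rewrite !(addrAC _ (e * _)) !subrr !add0r !normrM -!mulrDr => hrx.
  set X := L x _ _ _ - _ in hrx *.
  have -> : X - e * D x = (X - (m2 * (e * y1 x) + m3 * (e * u1 x) + m4 * (e * v1 x)))
      - e * E x by rewrite /E; ring.
  apply: (le_trans (ler_normB _ _)); rewrite [X in _ <= X * _]splitr mulrDl.
  apply: lerD; last by rewrite normrM mulrC ler_wpM2r.
  apply: (le_trans hrx); rewrite mulrCA mulrC ler_wpM2r//.
  by rewrite mulrAC ler_pdivrMr// ler_wpM2l// divr_ge0// ltW.
have hQ : \forall e \near (0 : R), `[A, B]%classic `<=` P e by exact: nc hP.
near=> e => x xAB.
have sub : `[A, B]%classic `<=` P e by near: e.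
have := sub x xAB xAB.
by rewrite /D clamp_id// abE.
Unshelve. all: by end_near. Qed.

(** The uniform expansion integrates to [J e = J 0 + e * ID + o(e)], and minimality for both signs
    of [e] forces [ID = 0]. *)
Lemma first_variation (R : realType) (a b A B d : R)
    (L : R -> R -> R -> R -> R) (Y U V y1 u1 v1 : R -> R) :
  a <= A -> A <= B -> B <= b -> C1_on_strip a b L ->
  continuous Y -> continuous U -> continuous V ->
  continuous y1 -> continuous u1 -> continuous v1 -> 0 < d ->
  (forall e, `|e| < d ->
    \int[lebesgue_measure]_(x in `[A, B]) L x (Y x) (U x) (V x) <=
    \int[lebesgue_measure]_(x in `[A, B])
      L x (Y x + e * y1 x) (U x + e * u1 x) (V x + e * v1 x)) ->
  \int[lebesgue_measure]_(x in `[A, B])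
    (partial2 L x (Y x) (U x) (V x) * y1 x +
     partial3 L x (Y x) (U x) (V x) * u1 x +
     partial4 L x (Y x) (U x) (V x) * v1 x) = 0.
Proof.
move=> aA AB Bb C1 cY cU cV cy1 cu1 cv1 d0 Jmin.
have ab : a <= b by rewrite (le_trans aA)// (le_trans AB).
have mAB : measurable ([set` `[A, B]] : set (measurableTypeR R)).
  exact: measurable_itv.
have cE x : x \in `[A, B] -> clamp a b x = x.
  rewrite in_itv/= => /andP[Ax xB]; apply: clamp_id.
  by rewrite in_itv/= (le_trans aA Ax) (le_trans xB Bb).
(* [F] separates the first argument of [L], the only one confined to [[a, b]]: clamping it alone
   gives a continuous integrand, unchanged on [[A, B]]. *)
have clampi (F : R -> R -> R) : continuous (fun x => F (clamp a b x) x) ->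
    lebesgue_measure.-integrable `[A, B] (EFin \o (fun x => F x x)).
  move=> cF; apply: (eq_integrable _ _ _ _ (continuous_integrable_itv A B cF)) => //.
  by move=> x; rewrite inE/= => xAB; rewrite cE.
pose l e x := L x (Y x + e * y1 x) (U x + e * u1 x) (V x + e * v1 x).
pose D x := partial2 L x (Y x) (U x) (V x) * y1 x +
  partial3 L x (Y x) (U x) (V x) * u1 x + partial4 L x (Y x) (U x) (V x) * v1 x.
have il e : lebesgue_measure.-integrable `[A, B] (EFin \o l e).
  have cp (f g : R -> R) : continuous f -> continuous g ->
      continuous (fun x => f x + e * g x).
    by move=> cf cg x; apply: cvgD; [exact: cf|apply: cvgMl_tmp; exact: cg].
  apply: (clampi (fun c x => L c (Y x + e * y1 x) (U x + e * u1 x) (V x + e * v1 x))).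
  by apply: continuous_C1_curve => //; exact: cp.
have iD : lebesgue_measure.-integrable `[A, B] (EFin \o D).
  have [_ [_ c2 c3 c4]] := C1.
  apply: (clampi (fun c x => partial2 L c (Y x) (U x) (V x) * y1 x +
    partial3 L c (Y x) (U x) (V x) * u1 x + partial4 L c (Y x) (U x) (V x) * v1 x)).
  move=> x; apply: cvgD; [apply: cvgD|]; apply: cvgM.
  - exact: (continuous_strip_curve ab c2 cY cU cV).
  - exact: cy1.
  - exact: (continuous_strip_curve ab c3 cY cU cV).
  - exact: cu1.
  - exact: (continuous_strip_curve ab c4 cY cU cV).
  - exact: cv1.
pose J e := \int[lebesgue_measure]_(x in `[A, B]) l e x.
pose ID := \int[lebesgue_measure]_(x in `[A, B]) D x.
have J0 e : `|e| < d -> J 0 <= J e.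
  move=> /Jmin; congr (_ <= _); apply: eq_Rintegral => x _.
  by rewrite /l !mul0r !addr0.
have bound eps : 0 < eps -> \forall e \near (0 : R),
    `|J e - J 0 - e * ID| <= eps * `|e| * (B - A).
  move=> eps0.
  have := C1_increment_uniform aA AB Bb C1 cY cU cV cy1 cu1 cv1 eps0.
  apply: filterS => e he.
  have ieD : lebesgue_measure.-integrable `[A, B] (EFin \o (fun x => e * D x)).
    exact (integrableZl mAB e iD).
  have i1 : lebesgue_measure.-integrable `[A, B] (EFin \o (fun x => l e x - l 0 x)).
    exact (integrableB mAB (il e) (il 0)).
  have i2 : lebesgue_measure.-integrable `[A, B]
      (EFin \o (fun x => l e x - l 0 x - e * D x)).
    exact (integrableB mAB i1 ieD).
  rewrite /J /ID -(RintegralB mAB (il e) (il 0)) -(RintegralZl _ mAB iD).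
  rewrite -(RintegralB mAB i1 ieD).
  apply: (le_trans (le_normr_Rintegral mAB i2)).
  have -> : eps * `|e| * (B - A) =
      \int[lebesgue_measure]_(x in `[A, B]) (cst (eps * `|e|) x).
    rewrite Rintegral_cst//= lebesgue_measure_itv/= lte_fin.
    by case: ltgtP AB => // ->; rewrite subrr !mulr0.
  apply: le_Rintegral => //.
  - exact: integrable_norm i2.
  - exact: continuous_integrable_itv (@cst_continuous _ _ _).
  - by move=> x xAB; have := he x xAB; rewrite /l !mul0r !addr0.
have ID_le eps : 0 < eps -> `|ID| <= eps * (B - A).
  move=> eps0; have /nbhs_ballP[r /= r0 hr] := bound _ eps0.
  (* Small enough for both minimality and the expansion; comparing [J 0] with [J t] and [J (- t)]
     bounds [ID] from below and from above. *)
  pose t := Num.min d r / 2.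
  have t0 : 0 < t by rewrite divr_gt0// lt_min d0 r0.
  have tm : t < Num.min d r by rewrite ltr_pdivrMr// ltr_pMr ?ltr1n// lt_min d0 r0.
  move: (tm); rewrite lt_min => /andP[td tr].
  have h1 := hr t; have h2 := hr (- t).
  move: h1 h2; rewrite /ball/= !sub0r !normrN gtr0_norm// => /(_ tr) h1 /(_ tr) h2.
  have j1 := J0 t; have j2 := J0 (- t); rewrite normrN gtr0_norm// in j1 j2.
  have {}j1 := j1 td; have {}j2 := j2 td.
  move: h1 h2; rewrite !ler_norml => /andP[_ l1] /andP[_ l2].
  have tE : t * (eps * (B - A)) = eps * t * (B - A) by ring.
  by rewrite -(ler_pM2l t0) -[X in _ && X](ler_pM2l t0) mulrN tE; apply/andP; split; lra.
apply/eqP; rewrite -normr_le0; apply/ler_addgt0Pl => e e0; rewrite addr0.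
(* Adding 1 keeps the divisor positive when [A = B]. *)
have BA0 : 0 < B - A + 1 by rewrite ltr_wpDl// subr_ge0.
apply: (le_trans (ID_le _ (divr_gt0 e0 BA0))).
by rewrite mulrAC ler_pdivrMr// ler_pM2l// lerDl.
Qed.

(** * The Euler-Lagrange equations *)

(** With [C] the mean of [H], the function [g = H - C] is itself admissible, and testing with it
    gives a zero integral of [g * g]. The integrals over [[a, x]] are squeezed to 0, so their
    derivative [g * g] vanishes inside the interval; the endpoints follow by continuity. *)
Lemma du_bois_reymond (R : realType) (a b : R) (H : R -> R) : a < b ->
  continuous H ->
  (forall g, continuous g -> \int[lebesgue_measure]_(t in `[a, b]) g t = 0 ->
    \int[lebesgue_measure]_(t in `[a, b]) (g t * H t) = 0) ->
  exists C, forall x, x \in `[a, b] -> H x = C.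
Proof.
move=> ab cH orth.
have mab : measurable ([set` `[a, b]] : set (measurableTypeR R)).
  exact: measurable_itv.
pose C := (\int[lebesgue_measure]_(t in `[a, b]) H t) / (b - a).
pose g t := H t - C.
have cg : continuous g by move=> x; apply: cvgB; [exact: cH|exact: cvg_cst].
have cgg : continuous (fun t => g t * g t).
  by move=> x; apply: cvgM; exact: cg.
have iC (r : R) := continuous_integrable_itv a b (@cst_continuous _ _ r).
have iH := continuous_integrable_itv a b cH.
have ig := continuous_integrable_itv a b cg.
have igg := continuous_integrable_itv a b cgg.
have g0 : \int[lebesgue_measure]_(t in `[a, b]) g t = 0.
  rewrite /g (RintegralB mab iH (iC C)) Rintegral_cst//= lebesgue_measure_itv/=.
  by rewrite lte_fin ab /= /C divfK ?subrr// subr_eq0 gt_eqF.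
have gg0 : \int[lebesgue_measure]_(t in `[a, b]) (g t * g t) = 0.
  have cgH : continuous (fun t => g t * H t).
    by move=> x; apply: cvgM; [exact: cg|exact: cH].
  have cgC : continuous (fun t => C * g t).
    by move=> x; apply: cvgMl_tmp; exact: cg.
  transitivity (\int[lebesgue_measure]_(t in `[a, b]) (g t * H t - C * g t)).
    by apply: eq_Rintegral => t _; rewrite {2}/g mulrBr (mulrC _ C).
  rewrite (RintegralB mab (continuous_integrable_itv a b cgH)
                          (continuous_integrable_itv a b cgC)).
  by rewrite orth// (RintegralZl _ mab ig) g0 mulr0 subrr.
have primE x : x \in `[a, b] ->
    \int[lebesgue_measure]_(t in `[a, x]) (g t * g t) = 0.
  rewrite in_itv/= => /andP[ax xb]; apply/eqP; rewrite eq_le; apply/andP; split.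
    rewrite -gg0; apply: fine_le.
    - apply: integrable_fin_num; first exact: measurable_itv.
      exact: continuous_integrable_itv.
    - exact: integrable_fin_num.
    - apply: ge0_subset_integral => //.
      + by have /integrableP[] := igg.
      + by move=> t _; rewrite lee_fin -expr2 sqr_ge0.
      + by apply: subset_itvl; rewrite bnd_simp.
  by apply: Rintegral_ge0 => t _; rewrite -expr2 sqr_ge0.
have goo x : x \in `]a, b[ -> g x = 0.
  move=> xab; have := xab; rewrite in_itv/= => /andP[ax xb].
  have [_ dE] := is_derive_primitive cgg ax.
  have := @near_eq_derive R R R _ (cst 0) x 1
    (_ : \forall s \near x, \int[lebesgue_measure]_(t in `[a, s]) (g t * g t) = cst 0 s).
  rewrite dE derive_cst => /(_ _) h.
  apply/eqP; rewrite -sqrf_eq0 expr2; apply/eqP; apply: h.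
  near=> s; apply: primE; apply: subset_itv_oo_cc; near: s.
  exact: near_in_itvoo.
exists C => x xab; apply/eqP; rewrite -subr_eq0 -/(g x); apply/eqP.
have [xa|xa] := eqVneq x a.
  rewrite xa; apply: (@cvg_unique _ _ (g t @[t --> a^'+])) => //.
    exact/cvg_at_right_filter/cg.
  apply: cvg_near_cst; near=> t; apply: goo.
  by rewrite in_itv/=; apply/andP; split; near: t;
    [exact: nbhs_right_gt|exact: nbhs_right_lt].
have [xb|xb] := eqVneq x b.
  rewrite xb; apply: (@cvg_unique _ _ (g t @[t --> b^'-])) => //.
    exact/cvg_at_left_filter/cg.
  apply: cvg_near_cst; near=> t; apply: goo.
  by rewrite in_itv/=; apply/andP; split; near: t;
    [exact: nbhs_left_gt|exact: nbhs_left_lt].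
apply: goo; move: xab; rewrite !in_itv/= !lt_neqAle => /andP[-> ->].
by rewrite eq_sym xa xb.
Unshelve. all: by end_near. Qed.

(** Perturbing the zero function shows that primitives of continuous functions belong to the space,
    see [caputo_primitive]. *)
Lemma caputo_space0 (R : realType) (a b al be : R) :
  caputo_space a b al be (fun=> 0).
Proof.
have ac : abs_continuous a b (fun=> 0 : R).
  move=> e e0; exists 1 => // n u v _ _ _.
  by rewrite big1// => i _; rewrite subrr normr0.
have d0 : derive1 (fun=> 0 : R) = (fun=> 0 : R).
  by apply/funext => t; rewrite derive1_cst.
have ae : {ae lebesgue_measure, forall t : R, t \in `]a, b[ -> derivable (fun=> 0 : R) t 1}.
  by apply: aeW => t _; exact: derivable_cst.
have lk g x : left_kernel g (derive1 (fun=> 0 : R)) x = fun=> 0.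
  by apply/funext => t; rewrite /left_kernel d0 mulr0.
have rk g x : right_kernel g (derive1 (fun=> 0 : R)) x = fun=> 0.
  by apply/funext => t; rewrite /right_kernel d0 mulr0.
have int0 (D : set R) : \int[lebesgue_measure]_(t in D) (fun=> 0 : R) t = 0.
  by rewrite /Rintegral integral0.
have li : caputo_left_int a al (fun=> 0) = fun=> 0.
  by apply/funext => x; rewrite /caputo_left_int lk int0 mulr0.
have ri : caputo_right_int b be (fun=> 0) = fun=> 0.
  by apply/funext => x; rewrite /caputo_right_int rk int0 mulr0.
have cl : caputo_left a al (fun=> 0) = fun=> 0.
  apply/funext => x; rewrite /caputo_left li; case: ifP => // _.
  by apply: cvg_lim => //; exact: cvg_cst.
have cr : caputo_right b be (fun=> 0) = fun=> 0.
  apply/funext => x; rewrite /caputo_right ri; case: ifP => // _.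
  by apply: cvg_lim => //; exact: cvg_cst.
split.
- split => //; last by rewrite li; exact: is_cvg_cst.
  by move=> x _; rewrite lk; exact: integrable0.
- by rewrite cl; apply: continuous_subspaceT; exact: cst_continuous.
- split => //; last by rewrite ri; exact: is_cvg_cst.
  by move=> x _; rewrite rk; exact: integrable0.
- by rewrite cr; apply: continuous_subspaceT; exact: cst_continuous.
Qed.

(** Uniqueness of limits, and with it the meaning of [derive_in], requires points of [[p, q]] other
    than [x] arbitrarily close to [x]. They are found to the right of [x] if [x < q], and to the
    left if [x = q]. *)
Lemma quotient_in_proper (R : realType) (p q x : R) : p < q -> x \in `[p, q] ->
  ProperFilter (within `[p, q] x^').
Proof.
move=> pq; rewrite in_itv/= => /andP[px xq].
apply: Build_ProperFilter_ex => P; rewrite /within/= => /nbhs_ballP[d /= d0 hd].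
have ex t : `|x - t| < d -> t != x -> p <= t <= q -> exists z, P z.
  by move=> xt tx ptq; exists t; apply: hd => //=; rewrite in_itv.
have [xq'|xq'] := ltP x q.
  pose t := x + Num.min (d / 2) (q - x).
  have m0 : 0 < Num.min (d / 2) (q - x) by rewrite lt_min divr_gt0// subr_gt0.
  have md : Num.min (d / 2) (q - x) <= d / 2 by rewrite ge_min lexx.
  have mq : Num.min (d / 2) (q - x) <= q - x by rewrite ge_min lexx orbT.
  apply: (ex t); rewrite /t.
  - rewrite opprD addrA subrr sub0r normrN gtr0_norm//; lra.
  - by rewrite gt_eqF// ltrDl.
  - by apply/andP; split; lra.
pose t := x - Num.min (d / 2) (x - p).
have m0 : 0 < Num.min (d / 2) (x - p).
  by rewrite lt_min divr_gt0// subr_gt0 (lt_le_trans pq).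
have md : Num.min (d / 2) (x - p) <= d / 2 by rewrite ge_min lexx.
have mp : Num.min (d / 2) (x - p) <= x - p by rewrite ge_min lexx orbT.
apply: (ex t); rewrite /t.
- rewrite opprD opprK addrA subrr add0r gtr0_norm//; lra.
- by rewrite lt_eqF// ltrBlDr ltrDl.
- by apply/andP; split; lra.
Qed.

Lemma cvg_quotient_in (R : realType) (p q : R) (f : R -> R) (x l : R) :
  p < q -> x \in `[p, q] -> quotient_in p q f x --> l ->
  derivable_in p q f x /\ derive_in p q f x = l.
Proof.
move=> pq xpq fl; have PF := quotient_in_proper pq xpq.
by split; [apply/cvg_ex; exists l|exact: cvg_lim fl].
Qed.

Lemma quotient_in_subset (R : realType) (p q p' q' : R) (f : R -> R) (x l : R) :
  p <= p' -> q' <= q -> quotient_in p q f x --> l -> quotient_in p' q' f x --> l.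
Proof.
move=> pp qq; apply: cvg_trans; apply: cvg_app; apply: within_subset.
move=> t /=; rewrite !in_itv/= => /andP[p't tq'].
by rewrite (le_trans pp p't) (le_trans tq' qq).
Qed.

Lemma eq_quotient_in (R : realType) (p q : R) (f h : R -> R) (x l : R) :
  {in `[p, q], f =1 h} -> x \in `[p, q] ->
  quotient_in p q f x --> l -> quotient_in p q h x --> l.
Proof.
move=> fh xpq; apply: cvg_trans; apply: near_eq_cvg; rewrite near_withinE.
by apply: nearW => t tpq; rewrite !fh.
Qed.

Lemma is_derive_quotient_in (R : realType) (p q : R) (f : R -> R) (x l : R) :
  is_derive x (1 : R) f l -> quotient_in p q f x --> l.
Proof.
move=> [df <-]; have := df; rewrite /derivable => /cvg_ex[l' hl'].
have -> : 'D_1 f x = l' by apply: cvg_lim.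
rewrite /quotient_in; apply: cvg_within_filter.
have hs : (fun t => t - x) t @[t --> x^'] --> (0 : R)^'.
  move=> U; rewrite /dnbhs /within/= => /nbhs_ballP[d /= d0 hd].
  apply/nbhs_ballP; exists d => // t /=; rewrite /ball/= => xt tx.
  by apply: hd; rewrite /ball/= ?sub0r ?opprB ?subr_eq0.
have := cvg_comp _ _ hs hl'; apply: cvg_trans; apply: near_eq_cvg.
apply: nearW => t /=; rewrite [_%:A]mulr1 subrK.
by rewrite -[LHS]/(_ * _) mulrC.
Qed.

Lemma frac_ker0 (R : realType) (s : R) : 0 < s -> frac_ker 0 s = 1.
Proof. by move=> s0; rewrite /frac_ker s0 oppr0 powRr0. Qed.

Lemma frac_conv0_left (R : realType) (c d x : R) (f : R -> R) :
  continuous f -> d <= x ->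
  frac_conv false 0 f c d x = \int[lebesgue_measure]_(t in `[c, d]) f t.
Proof.
move=> cf dx; rewrite /frac_conv -(Rintegral_itv_oo_cc (continuous_integrable_itv c d cf)).
rewrite -(Rintegral_itv_oo_cc (integrable_frac_conv false c d x ltr01 cf)).
apply: eq_Rintegral => t; rewrite inE/= in_itv/= => /andP[ct td].
by rewrite expr0 mul1r frac_ker0 ?mul1r// subr_gt0 (lt_le_trans td dx).
Qed.

Lemma frac_conv0_right (R : realType) (c d x : R) (f : R -> R) :
  continuous f -> x <= c ->
  frac_conv true 0 f c d x = \int[lebesgue_measure]_(t in `[c, d]) f t.
Proof.
move=> cf xc; rewrite /frac_conv -(Rintegral_itv_oo_cc (continuous_integrable_itv c d cf)).
rewrite -(Rintegral_itv_oo_cc (integrable_frac_conv true c d x ltr01 cf)).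
apply: eq_Rintegral => t; rewrite inE/= in_itv/= => /andP[ct td].
by rewrite expr1 mulN1r opprB frac_ker0 ?mul1r// subr_gt0 (le_lt_trans xc ct).
Qed.

(** Right fractional integrals only look beyond [x]. This removes the first two summands of [H] on
    [[B, b]], as [frac_conv_left_le] removes the third on [[a, A]]. *)
Lemma frac_conv_right_ge (R : realType) (g c d x : R) (f : R -> R) : d <= x ->
  frac_conv true g f c d x = 0.
Proof.
move=> dx; rewrite /frac_conv /Rintegral integral0_eq// => t /=.
rewrite in_itv/= => /andP[_ td]; rewrite frac_ker_le0 ?mul0r//.
by rewrite expr1 mulN1r opprB subr_le0 (le_trans td dx).
Qed.

Lemma frac_conv_left_le (R : realType) (g c d x : R) (f : R -> R) : x <= c ->
  frac_conv false g f c d x = 0.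
Proof.
move=> xc; rewrite /frac_conv /Rintegral integral0_eq// => t /=.
rewrite in_itv/= => /andP[ct _]; rewrite frac_ker_le0 ?mul0r//.
by rewrite expr0 mul1r subr_le0 (le_trans xc ct).
Qed.

Lemma frac_conv_split (R : realType) (b : bool) (g c d e x : R) (f : R -> R) :
  g < 1 -> continuous f -> c <= d -> d <= e ->
  frac_conv b g f c e x = frac_conv b g f c d x + frac_conv b g f d e x.
Proof.
move=> g1 cf cd de; have i1 := integrable_frac_conv b c e x g1 cf.
apply/eqP; rewrite addrC -subr_eq; apply/eqP.
rewrite /frac_conv Rintegral_itvB ?bnd_simp// Rintegral_itv_obnd_cbnd//.
apply: (integrableS _ _ _ i1); [exact: measurable_itv|exact: measurable_itv|].
by apply: subset_itvr; rewrite bnd_simp.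
Qed.

Lemma is_derive_primitive_right (R : realType) (f : R -> R) (A B x : R) :
  continuous f -> x \in `[A, B] ->
  quotient_in A B (fun s => \int[lebesgue_measure]_(t in `[s, B]) f t) x --> - f x.
Proof.
move=> cf xAB.
(* The base point [A - 1] lies strictly to the left of [[A, B]], so [P] has a two-sided derivative
   even at [x = A]. *)
pose P s := \int[lebesgue_measure]_(t in `[A - 1, s]) f t.
have PE s : s \in `[A, B] -> P B - P s = \int[lebesgue_measure]_(t in `[s, B]) f t.
  rewrite in_itv/= => /andP[As sB].
  have ifAB := continuous_integrable_itv (A - 1) B cf.
  rewrite /P Rintegral_itvB ?bnd_simp//; last by rewrite (le_trans _ As)// gerBl.
  rewrite Rintegral_itv_obnd_cbnd//.
  apply: (integrableS _ _ _ ifAB); [exact: measurable_itv|exact: measurable_itv|].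
  by apply: subset_itvr; rewrite bnd_simp (le_trans _ As)// gerBl.
apply: (eq_quotient_in PE xAB); apply: is_derive_quotient_in.
have xA : A - 1 < x.
  by move: xAB; rewrite in_itv/= => /andP[Ax _]; rewrite (lt_le_trans _ Ax)// gtrBl.
have dP := is_derive_primitive cf xA.
apply: (is_derive_eq (is_deriveB (is_derive_cst (P B) x 1) dP)).
by rewrite sub0r.
Qed.

Lemma continuous_along_clamp (R : realType) (a b al be : R)
    (F : R -> R -> R -> R -> R) (y : R -> R) : a <= b ->
  continuous_on_strip a b F -> caputo_space a b al be y ->
  continuous (along a b al be F y \o clamp a b).
Proof.
move=> ab cF [[acy _ _ _] cl _ cr].
exact: (continuous_strip_curve ab cF
  (within_continuous_clamp ab (abs_continuous_within acy))
  (within_continuous_clamp ab cl) (within_continuous_clamp ab cr)).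
Qed.

(** The variation of [y] is written as [frac_conv] with exponent 0, so that all three arguments of
    [L] are perturbed by Abel convolutions of [g] and [Rintegral_mul_frac_conv] serves for each. *)
Lemma Jstar_perturb (R : realType) (a b A B al be e : R)
    (L : R -> R -> R -> R -> R) (y g : R -> R) :
  a < b -> a <= A -> B <= b -> 0 < al < 1 -> 0 < be < 1 -> continuous g ->
  caputo_space a b al be y ->
  Jstar a b A B al be L
    (fun x => y x + e * \int[lebesgue_measure]_(s in `[a, x]) g s) =
  \int[lebesgue_measure]_(x in `[A, B])
    L x (y (clamp a b x) + e * frac_conv false 0 g a b x)
      (caputo_left a al y (clamp a b x) +
        e * ((Gamma (1 - al))^-1 * frac_conv false al g a b x))
      (caputo_right b be y (clamp a b x) +
        e * (- (Gamma (1 - be))^-1 * frac_conv true be g a b x)).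
Proof.
move=> ab aA Bb hal hbe cg Ey.
have [_ lE rE] := caputo_space_perturb e ab hal hbe cg Ey.
apply: eq_Rintegral => x; rewrite inE/= in_itv/= => /andP[Ax xB].
have ax : a <= x by exact: le_trans aA Ax.
have xb : x <= b by exact: le_trans xB Bb.
have xab : x \in `[a, b] by rewrite in_itv/= ax xb.
rewrite /along (lE x xab) (rE x xab) (clamp_id xab) -(frac_conv_left 0 a g xb).
by rewrite (frac_conv0_left a cg (lexx x)).
Qed.

Lemma caputo_primitive (R : realType) (a b al be : R) (g : R -> R) : a < b ->
  0 < al < 1 -> 0 < be < 1 -> continuous g ->
  caputo_space a b al be (fun x => \int[lebesgue_measure]_(s in `[a, x]) g s).
Proof.
move=> ab hal hbe cg.
have [+ _ _] := caputo_space_perturb 1 ab hal hbe cg (caputo_space0 a b al be).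
by under eq_fun do rewrite add0r mul1r.
Qed.

Lemma local_minimizer_perturb (R : realType) (a b al be ya yb : R)
    (N J : (R -> R) -> R) (y g : R -> R) :
  a < b -> 0 < al < 1 -> 0 < be < 1 -> continuous g ->
  \int[lebesgue_measure]_(t in `[a, b]) g t = 0 ->
  is_norm_on a b (caputo_space a b al be) N ->
  local_minimizer (caputo_space a b al be) N J
    (fun z => z a = ya /\ z b = yb) y ->
  exists2 d, 0 < d & forall e, `|e| < d ->
    J y <= J (fun x => y x + e * \int[lebesgue_measure]_(s in `[a, x]) g s).
Proof.
move=> ab hal hbe cg g0 [_ N0 _ NZ _] [Ey [yaE ybE] [d d0 Jmin]].
pose eta x := \int[lebesgue_measure]_(s in `[a, x]) g s.
have Eeta : caputo_space a b al be eta by exact: caputo_primitive.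
have Neta : 0 < N eta + 1 by rewrite ltr_wpDl// N0.
(* Adding 1 avoids dividing by [N eta], which may be 0. *)
exists (d / (N eta + 1)) => [|e ed]; first by rewrite divr_gt0.
apply: Jmin.
- by have [] := caputo_space_perturb e ab hal hbe cg Ey.
(* [eta] vanishes at [a] as an integral over a point, and at [b] because [g] has integral 0. *)
- by rewrite set_itv1 Rintegral_set1 g0 !mulr0 !addr0.
- have -> : y \- (fun x => y x + e * \int[lebesgue_measure]_(s in `[a, x]) g s) =
      fun x => (- e) * eta x.
    by apply/funext => x /=; rewrite /eta; ring.
  rewrite NZ// normrN; apply: (@le_lt_trans _ _ (`|e| * (N eta + 1))).
    by rewrite ler_wpM2l// lerDl.
  by rewrite -ltr_pdivlMr.
Qed.

Lemma Rintegral_lincomb (R : realType) (c d k l : R) (f g h : R -> R) :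
  continuous f -> continuous g -> continuous h ->
  \int[lebesgue_measure]_(x in `[c, d]) (f x + k * g x + l * h x) =
  \int[lebesgue_measure]_(x in `[c, d]) f x +
  k * \int[lebesgue_measure]_(x in `[c, d]) g x +
  l * \int[lebesgue_measure]_(x in `[c, d]) h x.
Proof.
move=> cf cg ch.
have mcd : measurable ([set` `[c, d]] : set (measurableTypeR R)).
  exact: measurable_itv.
have fi := continuous_integrable_itv c d cf.
have gi := continuous_integrable_itv c d cg.
have hi := continuous_integrable_itv c d ch.
have kgi := integrableZl mcd k gi.
rewrite (RintegralD mcd (integrableD mcd fi kgi) (integrableZl mcd l hi)).
by rewrite (RintegralD mcd fi kgi) (RintegralZl _ mcd gi) (RintegralZl _ mcd hi).
Qed.

Lemma euler_lagrange_integrated (R : realType) (a b A B al be ya yb : R)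
    (L : R -> R -> R -> R -> R) (N : (R -> R) -> R) (y : R -> R)
    (G2 := along a b al be (partial2 L) y \o clamp a b)
    (G3 := along a b al be (partial3 L) y \o clamp a b)
    (G4 := along a b al be (partial4 L) y \o clamp a b) :
  a < b -> a <= A -> A < B -> B <= b -> 0 < al < 1 -> 0 < be < 1 ->
  C1_on_strip a b L ->
  is_norm_on a b (caputo_space a b al be) N ->
  local_minimizer (caputo_space a b al be) N (Jstar a b A B al be L)
    (fun z => z a = ya /\ z b = yb) y ->
  exists C, forall x, x \in `[a, b] ->
    frac_conv true 0 G2 A B x +
    (Gamma (1 - al))^-1 * frac_conv true al G3 A B x -
    (Gamma (1 - be))^-1 * frac_conv false be G4 A B x = C.
Proof.
move=> ab aA AB Bb hal hbe C1 hN hy.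
have [Ey _ _] := hy.
have [_ [_ c2 c3 c4]] := C1.
have cG2 : continuous G2 := continuous_along_clamp (ltW ab) c2 Ey.
have cG3 : continuous G3 := continuous_along_clamp (ltW ab) c3 Ey.
have cG4 : continuous G4 := continuous_along_clamp (ltW ab) c4 Ey.
have cy : continuous (y \o clamp a b).
  have [[acy _ _ _] _ _ _] := Ey.
  exact: (within_continuous_clamp (ltW ab) (abs_continuous_within acy)).
have cl : continuous (caputo_left a al y \o clamp a b).
  by have [_ h _ _] := Ey; exact: (within_continuous_clamp (ltW ab) h).
have cr : continuous (caputo_right b be y \o clamp a b).
  by have [_ _ _ h] := Ey; exact: (within_continuous_clamp (ltW ab) h).
have h0 : 0 <= (0 : R) < 1 by rewrite lexx ltr01.
have hal' : 0 <= al < 1 by case/andP: hal => /ltW -> ->.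
have hbe' : 0 <= be < 1 by case/andP: hbe => /ltW -> ->.
have cc b' ga c d (f : R -> R) : 0 <= ga < 1 -> c <= d -> continuous f ->
    continuous (frac_conv b' ga f c d) by exact: continuous_frac_conv.
have cK (k : R) (f : R -> R) : continuous f -> continuous (fun x => k * f x).
  by move=> cf x; apply: cvgMl_tmp; exact: cf.
have cM (f h : R -> R) : continuous f -> continuous h -> continuous (fun x => f x * h x).
  by move=> cf ch x; apply: cvgM; [exact: cf|exact: ch].
have cD (f h : R -> R) : continuous f -> continuous h -> continuous (fun x => f x + h x).
  by move=> cf ch x; apply: cvgD; [exact: cf|exact: ch].
pose ca := (Gamma (1 - al))^-1; pose cb := - (Gamma (1 - be))^-1.
pose H2 := frac_conv true 0 G2 A B; pose H3 := frac_conv true al G3 A B.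
pose H4 := frac_conv false be G4 A B.
have cH2 : continuous H2 := cc true _ _ _ _ h0 (ltW AB) cG2.
have cH3 : continuous H3 := cc true _ _ _ _ hal' (ltW AB) cG3.
have cH4 : continuous H4 := cc false _ _ _ _ hbe' (ltW AB) cG4.
have cH : continuous (fun x => H2 x + ca * H3 x + cb * H4 x).
  by apply: (cD _ _ (cD _ _ cH2 (cK _ _ cH3)) (cK _ _ cH4)).
have [C HC] : exists C, forall x, x \in `[a, b] -> H2 x + ca * H3 x + cb * H4 x = C.
  apply: (du_bois_reymond ab cH) => g cg g0.
  have [d d0 Jmin] := local_minimizer_perturb ab hal hbe cg g0 hN hy.
  pose k2 := frac_conv false 0 g a b; pose k3 := frac_conv false al g a b.
  pose k4 := frac_conv true be g a b.
  have ck2 : continuous k2 := cc false _ _ _ _ h0 (ltW ab) cg.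
  have ck3 : continuous k3 := cc false _ _ _ _ hal' (ltW ab) cg.
  have ck4 : continuous k4 := cc true _ _ _ _ hbe' (ltW ab) cg.
  have := first_variation aA (ltW AB) Bb C1 cy cl cr ck2 (cK ca _ ck3) (cK cb _ ck4) d0.
  have AE x : x \in `[A, B] -> clamp a b x = x.
    rewrite in_itv/= => /andP[Ax xB]; apply: clamp_id.
    by rewrite in_itv/= (le_trans aA Ax) (le_trans xB Bb).
  have JE : Jstar a b A B al be L y = \int[lebesgue_measure]_(x in `[A, B])
      L x (y (clamp a b x)) (caputo_left a al y (clamp a b x))
        (caputo_right b be y (clamp a b x)).
    by apply: eq_Rintegral => x; rewrite inE/= => xAB; rewrite /along (AE x xAB).
  have Jle e (ed : `|e| < d) := Jmin e ed.
  rewrite JE in Jle.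
  have {}Jle e : `|e| < d -> _ := fun ed => eq_ind _ (fun r => _ <= r) (Jle e ed) _
    (Jstar_perturb e L ab aA Bb hal hbe cg Ey).
  move=> /(_ Jle) fv.
  (* Each fractional integral moves from [g] to a partial of [L] and changes side: the left ones
     give the right integrals [H2] and [H3], the right one gives the left integral [H4]. *)
  have F2 : \int[lebesgue_measure]_(x in `[A, B]) (G2 x * k2 x) =
      \int[lebesgue_measure]_(t in `[a, b]) (g t * H2 t).
    exact: (Rintegral_mul_frac_conv false h0 (ltW ab) (ltW AB) cG2 cg).
  have F3 : \int[lebesgue_measure]_(x in `[A, B]) (G3 x * k3 x) =
      \int[lebesgue_measure]_(t in `[a, b]) (g t * H3 t).
    exact: (Rintegral_mul_frac_conv false hal' (ltW ab) (ltW AB) cG3 cg).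
  have F4 : \int[lebesgue_measure]_(x in `[A, B]) (G4 x * k4 x) =
      \int[lebesgue_measure]_(t in `[a, b]) (g t * H4 t).
    exact: (Rintegral_mul_frac_conv true hbe' (ltW ab) (ltW AB) cG4 cg).
  clearbody H2 H3 H4 k2 k3 k4.
  transitivity (\int[lebesgue_measure]_(t in `[a, b])
      (g t * H2 t + ca * (g t * H3 t) + cb * (g t * H4 t))).
    by apply: eq_Rintegral => t _; ring.
  have E1 := Rintegral_lincomb a b ca cb (cM _ _ cg cH2) (cM _ _ cg cH3) (cM _ _ cg cH4).
  have E2 := Rintegral_lincomb A B ca cb (cM _ _ cG2 ck2) (cM _ _ cG3 ck3) (cM _ _ cG4 ck4).
  rewrite E1 -F2 -F3 -F4 -E2.
  rewrite -[RHS]fv; apply: eq_Rintegral => x; rewrite inE/= => xAB.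
  by rewrite /G2 /G3 /G4 /along /= (AE x xAB) -!(mulrCA ca) -!(mulrCA cb).
by exists C => x xab; rewrite -(HC x xab) /cb mulNr.
Qed.

Lemma quotient_in_lincomb (R : realType) (p q k l x f' g' h' : R) (f g h : R -> R) :
  quotient_in p q f x --> f' -> quotient_in p q g x --> g' ->
  quotient_in p q h x --> h' ->
  quotient_in p q (fun s => f s + k * g s + l * h s) x --> f' + k * g' + l * h'.
Proof.
move=> qf qg qh; rewrite /quotient_in.
have -> : (fun t => (f t + k * g t + l * h t - (f x + k * g x + l * h x)) / (t - x)) =
    fun t => (f t - f x) / (t - x) + k * ((g t - g x) / (t - x)) +
             l * ((h t - h x) / (t - x)).
  by apply/funext => t; ring.
by apply: cvgD; [apply: cvgD|]; [exact: qf|exact: cvgMl_tmp|exact: cvgMl_tmp].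
Qed.

Lemma quotient_in_cst (R : realType) (p q c x : R) :
  quotient_in p q (fun=> c) x --> (0 : R).
Proof. by apply: is_derive_quotient_in; exact: is_derive_cst. Qed.

Lemma Rintegral_right_kernel_conv (R : realType) (g c q s : R) (d f : R -> R) :
  0 < g -> {in `[c, q], d =1 f} -> s \in `[c, q] ->
  \int[lebesgue_measure]_(t in `[s, q]) right_kernel g d s t =
  frac_conv true g f c q s.
Proof.
rewrite [s \in _]in_itv/= => g0 df /andP[cs sq].
rewrite Rintegral_right_kernel// -(frac_conv_right g q f cs).
apply: eq_Rintegral => t; rewrite inE/= in_itv/= => /andP[st tq].
by rewrite df// in_itv/= tq (le_trans cs st).
Qed.

Lemma Rintegral_left_kernel_conv (R : realType) (g p c s : R) (d f : R -> R) :
  0 < g -> {in `[p, c], d =1 f} -> s \in `[p, c] ->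
  \int[lebesgue_measure]_(t in `[p, s]) left_kernel g d s t =
  frac_conv false g f p c s.
Proof.
rewrite [s \in _]in_itv/= => g0 df /andP[ps sc].
rewrite Rintegral_left_kernel// -(frac_conv_left g p f sc).
apply: eq_Rintegral => t; rewrite inE/= in_itv/= => /andP[pt ts].
by rewrite df// in_itv/= pt (le_trans ts sc).
Qed.

Unset Implicit Arguments.

(** The derivatives with base points [A] and [B] are not assumed to exist. As [lim] has a value even
    without convergence, their existence is stated next to the equations that involve them. *)
Theorem theorem3p1 (R : realType) (a b A B alpha beta ya yb : R)
    (L : R -> R -> R -> R -> R) (N : (R -> R) -> R) (y : R -> R)
    (hab : a < b) (haA : a <= A) (hAB : A < B) (hBb : B <= b)
    (halpha : 0 < alpha < 1) (hbeta : 0 < beta < 1)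
    (hL : C1_on_strip a b L)
    (hN : is_norm_on a b (caputo_space a b alpha beta) N)
    (hy : local_minimizer (caputo_space a b alpha beta) N
            (Jstar a b A B alpha beta L)
            (fun z => z a = ya /\ z b = yb) y)
    (d2L := along a b alpha beta (partial2 L) y)
    (d3L := along a b alpha beta (partial3 L) y)
    (d4L := along a b alpha beta (partial4 L) y)
    (hd3 : forall x, x \in `[a, B] -> RL_right_exists a B alpha d3L x)
    (hd3c : {within `[a, B], continuous (RL_right a B alpha d3L)})
    (hd4 : forall x, x \in `[A, b] -> RL_left_exists A b beta d4L x)
    (hd4c : {within `[A, b], continuous (RL_left A b beta d4L)}) :
  [/\ forall x, x \in `[A, B] ->
        d2L x + RL_right a B alpha d3L x + RL_left A b beta d4L x = 0,
      a < A -> forall x, x \in `[a, A] ->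
        RL_right_exists a A alpha d3L x /\
        RL_right a B alpha d3L x - RL_right a A alpha d3L x = 0 &
      B < b -> forall x, x \in `[B, b] ->
        RL_left_exists B b beta d4L x /\
        RL_left A b beta d4L x - RL_left B b beta d4L x = 0].
Proof.
have [Ey _ _] := hy.
have [_ [_ c2 c3 c4]] := hL.
pose G2 := d2L \o clamp a b; pose G3 := d3L \o clamp a b; pose G4 := d4L \o clamp a b.
have cG2 : continuous G2 := continuous_along_clamp (ltW hab) c2 Ey.
have cG3 : continuous G3 := continuous_along_clamp (ltW hab) c3 Ey.
have cG4 : continuous G4 := continuous_along_clamp (ltW hab) c4 Ey.
have [al0 al1] := andP halpha; have [be0 be1] := andP hbeta.
have [C HC] := euler_lagrange_integrated hab haA hAB hBb halpha hbeta hL hN hy.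
rewrite -/d2L -/d3L -/d4L -/G2 -/G3 -/G4 in HC.
have ca0 : (Gamma (1 - alpha))^-1 != 0.
  by rewrite invr_eq0 gt_eqF// Gamma_frac_gt0// (ltW al0).
have cb0 : (Gamma (1 - beta))^-1 != 0.
  by rewrite invr_eq0 gt_eqF// Gamma_frac_gt0// (ltW be0).
have GE (d : R -> R) (c e : R) : a <= c -> e <= b -> {in `[c, e], d =1 d \o clamp a b}.
  move=> ac eb t; rewrite in_itv/= => /andP[ct te] /=; rewrite clamp_id//.
  by rewrite in_itv/= (le_trans ac ct) (le_trans te eb).
have aB : a <= B by exact: le_trans haA (ltW hAB).
have Ab : A <= b by exact: le_trans (ltW hAB) hBb.
pose P3 (q s : R) := \int[lebesgue_measure]_(t in `[s, q]) right_kernel alpha d3L s t.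
pose P4 (p s : R) := \int[lebesgue_measure]_(t in `[p, s]) left_kernel beta d4L s t.
have P3E c q s : a <= c -> q <= b -> s \in `[c, q] ->
    P3 q s = frac_conv true alpha G3 c q s.
  move=> ac qb sc.
  exact: (Rintegral_right_kernel_conv al0 (GE d3L _ _ ac qb) sc).
have P4E p c s : a <= p -> c <= b -> s \in `[p, c] ->
    P4 p s = frac_conv false beta G4 p c s.
  move=> ap cb sc.
  exact: (Rintegral_left_kernel_conv be0 (GE d4L _ _ ap cb) sc).
have q3 x : x \in `[a, B] ->
    quotient_in a B (P3 B) x --> derive_in a B (P3 B) x by move=> /hd3[].
have q4 x : x \in `[A, b] ->
    quotient_in A b (P4 A) x --> derive_in A b (P4 A) x by move=> /hd4[].
have r3 q x : RL_right a q alpha d3L x =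
    - (Gamma (1 - alpha))^-1 * derive_in a q (P3 q) x by exact: erefl.
have r4 p x : RL_left p b beta d4L x =
    (Gamma (1 - beta))^-1 * derive_in p b (P4 p) x by exact: erefl.
have c0 p q c (x : R) := @quotient_in_cst R p q c x.
split.
- move=> x xAB; have := xAB; rewrite in_itv/= => /andP[Ax xB].
  have xab : x \in `[a, b] by rewrite in_itv/= (le_trans haA Ax) (le_trans xB hBb).
  have x3 : x \in `[a, B] by rewrite in_itv/= (le_trans haA Ax).
  have x4 : x \in `[A, b] by rewrite in_itv/= Ax (le_trans xB hBb).
  have h1 := is_derive_primitive_right cG2 xAB.
  (* The Riemann-Liouville derivatives are given on [[a, B]] and [[A, b]]; their quotients keep the
     same limits when restricted to [[A, B]], where the three summands are differentiated
     together. *)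
  have h3 := quotient_in_subset haA (lexx B) (q3 x x3).
  have h4 := quotient_in_subset (lexx A) hBb (q4 x x4).
  have hs := quotient_in_lincomb (k := (Gamma (1 - alpha))^-1)
    (l := - (Gamma (1 - beta))^-1) h1 h3 h4.
  have FC : {in `[A, B], (fun=> C) =1 fun s =>
      \int[lebesgue_measure]_(t in `[s, B]) G2 t +
      (Gamma (1 - alpha))^-1 * P3 B s + - (Gamma (1 - beta))^-1 * P4 A s}.
    move=> s sAB; have := sAB; rewrite in_itv/= => /andP[As sB].
    have sab : s \in `[a, b] by rewrite in_itv/= (le_trans haA As) (le_trans sB hBb).
    rewrite -(HC s sab) (P3E A B s haA hBb sAB) (P4E A B s haA hBb sAB) mulNr.
    by rewrite -(frac_conv_right 0 B G2 As) (frac_conv0_right B cG2 (lexx s)).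
  (* The derivative of the constant [C] is computed twice, from the summands and as 0; comparing the
     two gives the negative of the first equation. *)
  have [_ e1] := cvg_quotient_in hAB xAB hs.
  have [_ e2] := cvg_quotient_in hAB xAB (eq_quotient_in FC xAB (c0 A B C x)).
  have G2x : G2 x = d2L x by rewrite /G2 /= clamp_id.
  have := etrans (esym e1) e2; rewrite G2x.
  rewrite r3 r4; move: (Gamma (1 - alpha))^-1 (Gamma (1 - beta))^-1 => ca cb.
  move: (derive_in a B (P3 B) x) (derive_in A b (P4 A) x) (d2L x) => D3 D4 D2 h.
  by apply: oppr_inj; rewrite oppr0 -h; ring.
- move=> aA x xaA; have := xaA; rewrite in_itv/= => /andP[ax xA].
  have x3 : x \in `[a, B] by rewrite in_itv/= ax (le_trans xA (ltW hAB)).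
  (* On [[a, A]] the first summand of [H] is the full integral of [G2] over [[A, B]] and the third
     is 0, so [H = C] can be solved for the right fractional integral of [G3] over [[A, B]]: it is
     the constant [K]. *)
  pose K := (C - \int[lebesgue_measure]_(t in `[A, B]) G2 t) / (Gamma (1 - alpha))^-1.
  (* The integrals with base points [B] and [A] differ by [K]; the summand [0 * 0] only fits the
     shape of [quotient_in_lincomb]. *)
  have P3BA : {in `[a, A], (fun s => P3 B s + (- 1) * K + 0 * 0) =1 P3 A}.
    move=> s saA; have := saA; rewrite in_itv/= => /andP[as_ sA].
    have saB : s \in `[a, B] by rewrite in_itv/= as_ (le_trans sA (ltW hAB)).
    have sab : s \in `[a, b] by rewrite in_itv/= as_ (le_trans sA Ab).
    rewrite (P3E a B s (lexx a) hBb saB) (P3E a A s (lexx a) Ab saA).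
    rewrite (frac_conv_split true s al1 cG3 haA (ltW hAB)).
    have := HC s sab; rewrite (frac_conv0_right B cG2 sA).
    rewrite (frac_conv_left_le beta B G4 sA) mulr0 subr0 => HCs.
    suff -> : frac_conv true alpha G3 A B s = K by ring.
    by rewrite /K -HCs addrAC subrr add0r mulrC mulKf.
  have hA := quotient_in_lincomb (k := - 1) (l := 0)
    (quotient_in_subset (lexx a) (ltW hAB) (q3 x x3)) (c0 a A K x) (c0 a A 0 x).
  have [d3 e3] := cvg_quotient_in aA xaA (eq_quotient_in P3BA xaA hA).
  split; last by rewrite !r3 e3; ring.
  split => // s; rewrite in_itv/= => /andP[as_ sA].
  have [int3 _] := hd3 x x3.
  have saB : s \in `[a, B] by rewrite in_itv/= as_ (le_trans sA (ltW hAB)).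
  apply: (integrableS _ _ _ (int3 s saB)); [exact: measurable_itv|exact: measurable_itv|].
  by apply: subset_itvl; rewrite bnd_simp ltW.
- move=> Bb x xBb; have := xBb; rewrite in_itv/= => /andP[Bx xb].
  have x4 : x \in `[A, b] by rewrite in_itv/= xb (le_trans (ltW hAB) Bx).
  (* On [[B, b]] the first two summands of [H] vanish, so [H = C] says that the left fractional
     integral of [G4] over [[A, B]] is this constant. *)
  pose K := - C / (Gamma (1 - beta))^-1.
  have P4AB : {in `[B, b], (fun s => P4 A s + (- 1) * K + 0 * 0) =1 P4 B}.
    move=> s sBb; have := sBb; rewrite in_itv/= => /andP[Bs sb].
    have sAb : s \in `[A, b] by rewrite in_itv/= sb (le_trans (ltW hAB) Bs).
    have sab : s \in `[a, b] by rewrite in_itv/= sb (le_trans aB Bs).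
    rewrite (P4E A b s haA (lexx b) sAb) (P4E B b s aB (lexx b) sBb).
    rewrite (frac_conv_split false s be1 cG4 (ltW hAB) hBb).
    have := HC s sab; rewrite (frac_conv_right_ge 0 A G2 Bs).
    rewrite (frac_conv_right_ge alpha A G3 Bs) mulr0 addr0 sub0r => HCs.
    suff -> : frac_conv false beta G4 A B s = K by ring.
    by rewrite /K -HCs opprK mulrC mulKf.
  have hB := quotient_in_lincomb (k := - 1) (l := 0)
    (quotient_in_subset (ltW hAB) (lexx b) (q4 x x4)) (c0 B b K x) (c0 B b 0 x).
  have [d4 e4] := cvg_quotient_in Bb xBb (eq_quotient_in P4AB xBb hB).
  split; last by rewrite !r4 e4; ring.
  split => // s; rewrite in_itv/= => /andP[Bs sb].
  have [int4 _] := hd4 x x4.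
  have sAb : s \in `[A, b] by rewrite in_itv/= sb (le_trans (ltW hAB) Bs).
  apply: (integrableS _ _ _ (int4 s sAb)); [exact: measurable_itv|exact: measurable_itv|].
  by apply: subset_itvr; rewrite bnd_simp ltW.
Qed.
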